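(* There exist absolute constants $C,C'>0$ such that the following holds. Let $\beta^*\in\mathbb R^d$, $\mathbf X\in\mathbb R^{n\times d}$ with i.i.d. $N(0,1)$ entries, and $\eta\in\mathbb R^n$ deterministic with $|\{i:|\eta_i|\le1\}|\ge\alpha n$ for some $\alpha\in(0,1]$; let $\mathbf y=\mathbf X\beta^*+\eta$. Suppose $\Delta\ge3(1+\|\beta^*\|)$, $\epsilon\in(0,1/2]$ and $n\ge C\cdot\frac{d\ln\Delta}{\alpha^2}\big(\ln(d/\epsilon)+\ln\ln\Delta\big)$. Let $\hat\beta$ be the output of the Bootstrapped Median Algorithm on input $(\mathbf y,\mathbf X,\Delta)$. Then with probability at least $1-\epsilon$, \[\tfrac1n\|\mathbf X(\beta^*-\hat\beta)\|^2\le C'\cdot\frac{d\log(d/\epsilon)}{\alpha^2 n}.\]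
   Context: Coordinate-wise Median Algorithm on input $(y,X)\in\mathbb R^m\times\mathbb R^{m\times d}$: sample fresh independent $w_i\sim N(0,1)$ and Rademacher signs $\sigma_i$ ($i\in[m]$), independent of everything else, and set $y'_i=\sigma_iy_i+w_i$, $X'_{i,\cdot}=\sigma_iX_{i,\cdot}$. For each $j\in[d]$ let $M_j=\{i:|X'_{ij}|\ge1/2\}$ and let $\hat\beta_j$ be the median of $\{y'_i/X'_{ij}: i\in M_j\}$. Output $\hat\beta=(\hat\beta_1,\dots,\hat\beta_d)$. Bootstrapped Median Algorithm on input $(y,X,\Delta)$, $\Delta\ge3$: let $t=\lceil\ln\Delta\rceil$; partition $[n]$ uniformly at random into disjoint sets $S_1,\dots,S_t$ (plus possibly leftover indices) with $|S_1|=\dots=|S_{t-1}|=\lfloor n/(2t)\rfloor$ and $|S_t|=\lfloor n/2\rfloor$. For $i=1,\dots,t$ run the Coordinate-wise Median Algorithm on $\big(y_{S_i}-X_{S_i}\sum_{j<i}\hat\beta^{(j)},\,X_{S_i}\big)$ and call the output $\hat\beta^{(i)}$. Output $\hat\beta=\sum_{i=1}^t\hat\beta^{(i)}$. Here $y_S$, $X_S$ denote the restrictions to the entries/rows in $S$. *)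

(* Defs.v *)
From HB Require Import structures.
From mathcomp Require Import all_boot all_order all_algebra all_fingroup.
From mathcomp Require Import all_classical all_reals all_analysis.
Set Implicit Arguments. Unset Strict Implicit. Unset Printing Implicit Defensive.
Import Order.TTheory GRing.Theory Num.Theory.
Local Open Scope classical_set_scope.
Local Open Scope ring_scope.

Section Algo.
Variable R : realType.

(* Median of a finite list of reals: lower median (element of rank
   ceil(k/2) in sorted order); 0 for the empty list. *)
Definition median (s : seq R) : R :=
  nth 0 (sort <=%R s) ((size s).-1./2).

Variables (n d : nat).

(* Coordinate-wise Median Algorithm run on the rows in S, with fresh
   Gaussian noise w and Rademacher signs sg (only rows in S are used). *)
Definition cw_median (S : {set 'I_n}) (y : 'I_n -> R) (X : 'I_n -> 'I_d -> R)
    (w sg : 'I_n -> R) : 'I_d -> R :=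
  fun j => median [seq (sg i * y i + w i) / (sg i * X i j)
                  | i <- enum S & 1 / 2 <= `|sg i * X i j| ].

Definition nrounds (Delta : R) : nat := `|Num.ceil (ln Delta)|%N.

Definition small_block (t : nat) : nat := n %/ (2 * t).

(* positions p (in the random order) belonging to block k (0-based, k < t):
   blocks 0..t-2 have size floor(n/(2t)), block t-1 has size floor(n/2). *)
Definition in_block (t k p : nat) : bool :=
  let b := small_block t in
  if (k < t.-1)%N then (k * b <= p < k.+1 * b)%N
  else (t.-1 * b <= p < t.-1 * b + n./2)%N.

(* the uniformly random partition S_1..S_t, obtained from a uniformly random
   permutation pi of [n]: S_{k+1} = pi(positions of block k) *)
Definition block_set (pi : {perm 'I_n}) (t k : nat) : {set 'I_n} :=
  [set pi p | p : 'I_n & in_block t k p].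

(* Bootstrapped Median Algorithm; W k, Sg k are the fresh randomness of
   round k+1. acc k = sum of the first k round outputs. *)
Fixpoint boot_acc (pi : {perm 'I_n}) (t : nat) (y : 'I_n -> R)
    (X : 'I_n -> 'I_d -> R) (W Sg : nat -> 'I_n -> R) (k : nat) : 'I_d -> R :=
  match k with
  | 0 => fun _ => 0
  | k'.+1 =>
    let a := boot_acc pi t y X W Sg k' in
    fun j => a j + cw_median (block_set pi t k')
                      (fun i => y i - \sum_(l < d) X i l * a l) X (W k') (Sg k') j
  end.

Definition bootstrapped_median (Delta : R) (pi : {perm 'I_n}) (y : 'I_n -> R)
    (X : 'I_n -> 'I_d -> R) (W Sg : nat -> 'I_n -> R) : 'I_d -> R :=
  boot_acc pi (nrounds Delta) y X W Sg (nrounds Delta).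

End Algo.

(* Index set of the real-valued sources of randomness:
   entries of X, Gaussian noises w of rounds < t, signs of rounds < t. *)
Definition rand_index (n d t : nat) : finType :=
  (('I_n * 'I_d) + ('I_t * 'I_n) + ('I_t * 'I_n))%type.

Section Indep.
Context {R : realType} {dT : measure_display} {T : measurableType dT}.
Variable P : probability T R.
Variables (n d t : nat).

Definition rand_family (X : 'I_n -> 'I_d -> T -> R) (W Sg : nat -> 'I_n -> T -> R)
    (k : rand_index n d t) : T -> R :=
  match k with
  | inl (inl (i, j)) => X i j
  | inl (inr (r, i)) => W (val r) i
  | inr (r, i) => Sg (val r) i
  end.

Definition mutually_independent (Pi : T -> {perm 'I_n})
    (Z : rand_index n d t -> T -> R) : Prop :=
  forall (A : set {perm 'I_n}) (B : rand_index n d t -> set R),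
    (forall k, measurable (B k)) ->
    P (Pi @^-1` A `&` \bigcap_k (Z k @^-1` B k)) =
    (P (Pi @^-1` A) * \prod_(k : rand_index n d t) P (Z k @^-1` B k))%E.
End Indep.

(* Main.v *)
Require Import Defs.
From HB Require Import structures.
From mathcomp Require Import all_boot all_order all_algebra all_fingroup.
From mathcomp Require Import all_classical all_reals all_analysis.
From mathcomp Require Import measurable_realfun.
From mathcomp Require Import ring lra zify.
Set Implicit Arguments. Unset Strict Implicit. Unset Printing Implicit Defensive.
Import Order.TTheory GRing.Theory Num.Theory.
Import numFieldTopology.Exports.
Local Open Scope classical_set_scope.
Local Open Scope ring_scope.

(* Given the partition, the rows of a round are independent of the estimate with
   which it starts. Let u be the error of that estimate. The ratio of row i in
   coordinate j is u_j + (A + eta_i) / X_ij, where A is a centred Gaussian of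
   variance at most 1 + |u|^2, independent of X_ij. Flipping X_ij shows that the
   ratio is as likely to exceed u_j + r as to fall below u_j - r, and for
   |eta_i| <= 1 and r >= tau sqrt (1 + |u|^2) it lies within r of u_j with
   probability at least c tau. So the rows are biased against u_j + r and
   against u_j - r, and a Chernoff bound for their votes confines the median to
   within r of u_j, that is, each coordinate of the new error to [-r, r]. With
   tau = 1 / (e sqrt d) the squared error contracts by e^-2 in each of about
   ln Delta rounds; the last, large block is run with tau^2 of order
   ln (d / eps) / (alpha^2 n). Sampling without replacement gives every block its
   share of the rows with small eta, and a net argument bounds |X v|^2 by a
   multiple of n |v|^2 for all v at once. *)

(** * Independent sub-sigma-algebras *)

(** The obstacle is dependence: the estimate entering a round is a function of earlier rows, and the
    blocks are themselves random. The permutation is therefore first fixed to a value s. The sources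
    then split into two disjoint index sets, [past] and [fresh], and Tonelli lets a tail bound be
    proved for a frozen past. The permutation returns at the end as an average over its n! values,
    which are independent of the events of the rounds with fixed blocks. The constants follow from
    one exponent: a block of m rows misses a coordinate by tau sqrt (1 + |u|^2) with probability of
    order exp (- c tau^2 alpha^2 m). With m of order n / ln Delta and tau^2 of order 1 / d this is
    the assumed sample size, and the union over the rounds costs the ln ln Delta. Precision is
    bought only once the error is bounded by a constant, with a single block of n / 2 rows, so the
    final error pays no ln Delta. The added noise w keeps the variance of A at least 1: its law is
    never degenerate, and its density stays under control after a shift by |eta_i| <= 1. *)

Section Decoupling.
Context {R : realType} {dT : measure_display} {T : measurableType dT}.
Variables (P : probability T R) (K : finType) (Z : K -> T -> R).
Hypothesis mZ : forall k, measurable_fun setT (Z k).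
Hypothesis indepZ : forall B : K -> set R, (forall k, measurable (B k)) ->
  (P (\bigcap_k (Z k @^-1` B k)) = \prod_k P (Z k @^-1` B k))%E.
Implicit Types I J : {set K}.

Definition cylinders I : set (set T) :=
  [set A | exists2 B : K -> set R, (forall k, measurable (B k)) &
     (forall k, k \notin I -> B k = setT) /\ A = \bigcap_k (Z k @^-1` B k)].

(* T with the sigma-algebra generated by the Z k, k in I. *)
Definition coarse I : measurableType (cylinders I).-sigma := g_sigma_algebraType (cylinders I).

Lemma cylinders_setI I : setI_closed (cylinders I).
Proof.
move=> _ _ [B mB [BI ->]] [C mC [CI ->]].
exists (fun k => B k `&` C k); first by move=> k; exact: measurableI.
split; first by move=> k kI; rewrite BI// CI// setIT.
by rewrite -bigcapI; apply: eq_bigcapr.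
Qed.

Lemma cylindersT I : cylinders I setT.
Proof.
exists (fun=> setT); first by [].
by split => //; apply/seteqP; split.
Qed.

Lemma cylinders_measurable I : cylinders I `<=` measurable.
Proof.
move=> _ [B mB [_ ->]]; apply: fin_bigcap_measurable; first exact: finite_finset.
by move=> k _; rewrite -[X in measurable X]setTI; exact: mZ.
Qed.

Lemma coarse_measurable I (A : set T) :
  measurable (A : set (coarse I)) -> measurable A.
Proof.
by apply: smallest_sub; [exact: sigma_algebra_measurable|exact: cylinders_measurable].
Qed.

Lemma cylinders_sub I J : I \subset J -> cylinders I `<=` cylinders J.
Proof.
move=> IJ _ [B mB [BI ->]]; exists B => //; split=> // k kJ.
by apply: BI; apply: contra kJ; exact: (fintype.subsetP IJ).
Qed.

Lemma coarse_sub I J (A : set T) : I \subset J ->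
  measurable (A : set (coarse I)) -> measurable (A : set (coarse J)).
Proof.
move=> IJ; apply: smallest_sub; first exact: smallest_sigma_algebra.
by move=> B /(cylinders_sub IJ) ?; exact: sub_sigma_algebra.
Qed.

Lemma measurable_coarse_fun I d' (U : measurableType d') (f : T -> U) :
  measurable_fun setT (f : coarse I -> U) -> measurable_fun setT f.
Proof.
by move=> mf _ B mB; have := mf measurableT B mB; exact: coarse_measurable.
Qed.

Lemma measurable_coarse_sub I J d' (U : measurableType d') (f : T -> U) :
  I \subset J -> measurable_fun setT (f : coarse I -> U) ->
  measurable_fun setT (f : coarse J -> U).
Proof.
by move=> IJ mf _ B mB; have := mf measurableT B mB; exact: coarse_sub.
Qed.

Lemma measurable_coord I k : k \in I -> measurable_fun setT (Z k : coarse I -> R).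
Proof.
move=> kI _ B mB; rewrite setTI; apply: sub_sigma_algebra.
exists (fun k' => if k' == k then B else setT); first by move=> k'; case: ifP.
split; first by move=> k'; case: eqP => // ->; rewrite kI.
apply/seteqP; split=> [x Bx k' _|x /(_ k)]/=; last by rewrite eqxx; exact.
by case: eqP => // ->.
Qed.

Lemma cylinders_indep I J A B : (forall k, k \in I -> k \notin J) ->
  cylinders I A -> cylinders J B -> (P (A `&` B) = P A * P B)%E.
Proof.
move=> IJ [a ma [aI ->]] [b mb [bJ ->]].
rewrite -bigcapI.
rewrite (eq_bigcapr (G := fun k => Z k @^-1` (a k `&` b k))); last by move=> k _; rewrite preimage_setI.
rewrite !indepZ//; last by move=> k; exact: measurableI.
rewrite -big_split/=; apply: eq_bigr => k _.
have [kI|kI] := boolP (k \in I).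
  by rewrite (bJ k (IJ _ kI)) !preimage_setT setIT probability_setT mule1.
by rewrite aI// !preimage_setT setTI probability_setT mul1e.
Qed.

(** For fixed B both sides are finite measures in A, a restriction and a multiple of P. They agree
    on the cylinders, which are stable under intersection, hence on the sigma-algebra that these
    generate. *)
Let indep_ext I (B : set T) : measurable B ->
  (forall A, cylinders I A -> (P (A `&` B) = P A * P B)%E) ->
  forall A, measurable (A : set (coarse I)) -> (P (A `&` B) = P A * P B)%E.
Proof.
move=> mB AB A mA.
pose m1 := mrestr P mB.
have PB : P B = (fine (P B))%:E by rewrite fineK// fin_num_measure.
pose m2 := mscale (NngNum (fine_ge0 (measure_ge0 P B))) P.
suff : m1 A = m2 A by rewrite /m1/= /mrestr /m2/= /mscale/= => ->; rewrite -PB muleC.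
apply: (@g_sigma_algebra_measure_unique _ _ _ (cylinders I) _ (fun=> setT)) => //.
- exact: cylinders_measurable.
- by move=> _; exact: cylindersT.
- by apply/seteqP; split=> // x _; exists 0%N.
- exact: cylinders_setI.
- by move=> C CI; rewrite /m1/= /mrestr /m2/= /mscale/= -PB muleC; exact: AB.
- by move=> _; rewrite /m1/= /mrestr setTI; have := fin_num_measure P _ mB; rewrite ge0_fin_numE.
Qed.

(** The extension is made twice: from cylinders to [coarse I] with B fixed, then from cylinders to
    [coarse J] with a cylinder of I fixed. *)
Lemma coarse_indep I J A B : (forall k, k \in I -> k \notin J) ->
  measurable (A : set (coarse I)) -> measurable (B : set (coarse J)) ->
  (P (A `&` B) = P A * P B)%E.
Proof.
move=> IJ mA mB.
apply: (indep_ext (coarse_measurable mB)) => // C CI.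
rewrite setIC muleC.
apply: (@indep_ext J) => //; first exact: (cylinders_measurable CI).
move=> D DJ; rewrite setIC muleC; exact: cylinders_indep IJ CI DJ.
Qed.

Let mid I : measurable_fun setT (fun x : T => (x : coarse I)).
Proof. by move=> _ B mB; rewrite setTI; exact: coarse_measurable mB. Qed.

Let mdiag I J : measurable_fun setT (fun x : T => ((x : coarse I), (x : coarse J))).
Proof. exact: (measurable_fun_pair (@mid I) (@mid J)). Qed.

(** Independence makes the law of the diagonal map x |-> (x, x) into [coarse I * coarse J] the
    product of its marginals; the rest is Tonelli. *)
Lemma decoupling I J (F : coarse I * coarse J -> \bar R) : (forall k, k \in I -> k \notin J) ->
  measurable_fun [set: (coarse I * coarse J)%type] F -> (forall x, 0 <= F x)%E ->
  (\int[P]_x F (x, x) = \int[P]_x \int[P]_y F (x, y))%E.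
Proof.
move=> IJ mF F0.
pose midI : {mfun T >-> coarse I} := HB.pack (fun x : T => (x : coarse I)) (isMeasurableFun.Build _ _ _ _ _ (@mid I)).
pose midJ : {mfun T >-> coarse J} := HB.pack (fun x : T => (x : coarse J)) (isMeasurableFun.Build _ _ _ _ _ (@mid J)).
pose mdI : {mfun T >-> (coarse I * coarse J)%type} := HB.pack (fun x : T => ((x : coarse I), (x : coarse J))) (isMeasurableFun.Build _ _ _ _ _ (@mdiag I J)).
pose PI := distribution P midI.
pose PJ := distribution P midJ.
transitivity (\int[distribution P mdI]_z F z)%E.
  by rewrite ge0_integral_distribution.
transitivity (\int[PI \x PJ]_z F z)%E.
  apply: eq_measure_integral => A mA _ /=.
  apply/esym; apply: (@product_measure_unique _ _ _ _ _ PI PJ (distribution P mdI)) => // B C mB mC.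
  exact: (coarse_indep IJ mB mC).
rewrite fubini_tonelli1// /fubini_F.
rewrite /PI ge0_integral_distribution//.
- apply: eq_integral => x _ /=.
  rewrite ge0_integral_distribution//.
  exact: measurableT_comp.
- exact: measurable_fun_fubini_tonelli_F.
- by move=> x; exact: integral_ge0.
Qed.

Lemma decoupling_prob I J (E : set (coarse I * coarse J)) : (forall k, k \in I -> k \notin J) ->
  measurable E -> (P [set x : T | E (x, x)] = \int[P]_x P [set y : T | E (x, y)])%E.
Proof.
move=> IJ mE.
have mF : measurable_fun [set: (coarse I * coarse J)%type] (EFin \o \1_E : _ -> \bar R).
  by apply/measurable_EFinP; exact: measurable_indic.
have := decoupling IJ mF; rewrite -[X in (P X = _)%E]setIT.
have mD : measurable [set x : T | E (x, x)].
  rewrite -[X in measurable X]setTI; exact: (@mdiag I J measurableT _ mE).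
have -> : (\int[P]_x (EFin \o \1_E) (x, x) = P ([set x : T | E (x, x)] `&` setT))%E.
  by rewrite -integral_indic.
move=> ->; last by move=> x; rewrite lee_fin.
apply: eq_integral => x _; rewrite -[X in (_ = P X)%E]setIT -integral_indic//; last first.
  apply: (@coarse_measurable J).
  have -> : [set y : T | E (x, y)] = xsection E x.
    by apply/seteqP; split=> y; rewrite /xsection/= ?inE.
  exact: measurable_xsection.
Qed.

(** This does the work of conditioning: a bound proved for every frozen value of the sources in I
    passes to the joint event. *)
Lemma decoupling_le I J (E : set (coarse I * coarse J)) (e : R) :
  (forall k, k \in I -> k \notin J) -> measurable E ->
  (forall x, P [set y : T | E (x, y)] <= e%:E)%E -> (P [set x : T | E (x, x)] <= e%:E)%E.
Proof.
move=> IJ mE Ee; rewrite (decoupling_prob IJ mE).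
have e0 : (0 <= e%:E)%E by exact: le_trans (Ee point).
apply: (@le_trans _ _ (\int[P]_x e%:E)%E); last by rewrite integral_cst//= probability_setT mule1.
apply: ge0_le_integral => //.
(* The probability of a section is an inner integral of Tonelli's theorem, hence measurable in x. *)
have -> : (fun x => P [set y : T | E (x, y)]) = (fun x => fubini_F (distribution P (HB.pack (fun x : T => (x : coarse J)) (isMeasurableFun.Build _ _ _ _ _ (@mid J)) : {mfun T >-> coarse J})) (EFin \o \1_E) x).
  apply/funext => x; rewrite indic_fubini_tonelli_FE//=.
  congr (P _); apply/seteqP; split=> y; rewrite /xsection/= ?inE//.
apply: (@measurable_coarse_fun I).
apply: measurable_fun_fubini_tonelli_F => //.
by apply/measurable_EFinP; exact: measurable_indic.
by move=> x; rewrite lee_fin.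
Qed.

Lemma indep_integralM I J (f g : T -> R) : (forall k, k \in I -> k \notin J) ->
  measurable_fun setT (f : coarse I -> R) -> measurable_fun setT (g : coarse J -> R) ->
  (forall x, 0 <= f x) -> (forall x, 0 <= g x) ->
  (\int[P]_x (f x * g x)%:E = \int[P]_x (f x)%:E * \int[P]_x (g x)%:E)%E.
Proof.
move=> IJ mf mg f0 g0.
pose F (z : coarse I * coarse J) := (f z.1 * g z.2)%:E.
have mF : measurable_fun [set: (coarse I * coarse J)%type] F.
  apply/measurable_EFinP; apply: measurable_funM.
    by apply: (measurableT_comp mf); exact: measurable_fst.
  by apply: (measurableT_comp mg); exact: measurable_snd.
rewrite (decoupling IJ mF) /F/=; last by move=> x; rewrite lee_fin mulr_ge0.
have mf' : measurable_fun setT (EFin \o f : T -> \bar R).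
  by apply/measurable_EFinP; exact: measurable_coarse_fun mf.
have mg' : measurable_fun setT (EFin \o g : T -> \bar R).
  by apply/measurable_EFinP; exact: measurable_coarse_fun mg.
rewrite -ge0_integralZr//=; last 2 first.
- by move=> x _; rewrite lee_fin.
- by apply: integral_ge0 => x _; rewrite lee_fin.
apply: eq_integral => x _; rewrite -ge0_integralZl//=; last 2 first.
  by move=> y _; rewrite lee_fin.
  by rewrite lee_fin.
Qed.

Lemma indep_integral_prod (X : eqType) (s : seq X) (G : X -> {set K}) (f : X -> T -> R) :
  uniq s -> (forall i j, i \in s -> j \in s -> i != j -> forall k, k \in G i -> k \notin G j) ->
  (forall i, i \in s -> measurable_fun setT (f i : coarse (G i) -> R)) ->
  (forall i x, 0 <= f i x) ->
  (\int[P]_x (\prod_(i <- s) f i x)%:E = \prod_(i <- s) \int[P]_x (f i x)%:E)%E.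
Proof.
move=> + + + f0.
elim: s => [|a s IH] /= us dis mf.
  under eq_integral do rewrite big_nil.
  by rewrite big_nil integral_cst//= probability_setT mule1.
move: us => /andP[as_ us].
pose J := [set k | has (fun i => k \in G i) s]%SET.
have mJ : measurable_fun setT ((fun x => \prod_(i <- s) f i x) : coarse J -> R).
  apply: measurable_prod => i is_.
  apply: (@measurable_coarse_sub (G i)); last by apply: mf; rewrite inE is_ orbT.
  by apply/fintype.subsetP => k kG; rewrite inE; apply/hasP; exists i.
under eq_integral do rewrite big_cons.
rewrite big_cons (@indep_integralM (G a) J)//.
- congr (_ * _)%E; apply: IH => // [i j is_ js|i is_].
    by apply: dis; rewrite inE ?is_ ?js orbT.
  by apply: mf; rewrite inE is_ orbT.
- move=> k kG; rewrite inE; apply/hasPn => i is_.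
  apply: contraL kG => kG.
  apply: (dis i) => //; rewrite ?inE ?is_ ?eqxx ?orbT//.
  by apply: contraNneq as_ => <-.
- by apply: mf; rewrite inE eqxx.
- by move=> x; apply: prodr_ge0.
Qed.

End Decoupling.

(** * Gaussian laws *)

Section MeasurableSets.
Context {R : realType} {d} {T : measurableType d}.
Implicit Types f g : T -> R.

Lemma measurable_le_set f g : measurable_fun setT f -> measurable_fun setT g ->
  measurable [set x | f x <= g x].
Proof.
move=> mf mg; have mt : measurable [set true] by [].
by have := measurable_fun_ler mf mg measurableT mt; rewrite setTI.
Qed.

Lemma measurable_lt_set f g : measurable_fun setT f -> measurable_fun setT g ->
  measurable [set x | f x < g x].
Proof.
move=> mf mg; have mt : measurable [set true] by [].
by have := measurable_fun_ltr mf mg measurableT mt; rewrite setTI.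
Qed.

Lemma measurable_sum_seq (X : eqType) (s : seq X) (h : X -> T -> R) :
  (forall i, i \in s -> measurable_fun setT (h i)) ->
  measurable_fun setT (fun x => \sum_(i <- s) h i x).
Proof.
elim: s => [|i s IH] mh.
  by under eq_fun do rewrite big_nil; exact: measurable_cst.
under eq_fun do rewrite big_cons.
apply: measurable_funD; first by apply: mh; rewrite mem_head.
by apply: IH => j js; apply: mh; rewrite inE js orbT.
Qed.

End MeasurableSets.

Section Gauss.
Context {R : realType}.
Local Notation mu := (@lebesgue_measure R).

Lemma measurable_inv : measurable_fun setT (GRing.inv : R -> R).
Proof.
(* The form x * (x^2)^-1 moves the inversion to a nonnegative argument, where it is a [powR]; at 0
   both sides are 0. *)
have -> : (GRing.inv : R -> R) = (fun x => x * powR (x ^+ 2) (- 1)).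
  apply/funext => x; rewrite powR_inv1 ?sqr_ge0//.
  have [->|x0] := eqVneq x 0; first by rewrite invr0 mul0r.
  by rewrite expr2 invfM mulrA divff// mul1r.
apply: measurable_funM => //.
by apply: (measurableT_comp (measurable_powR (- 1))); exact: measurable_funX.
Qed.

Lemma lebesgue_measure_shift (c : R) (A : set R) : measurable A ->
  pushforward mu ((fun x => x + c) : R -> measurableTypeR R) A = mu A.
Proof.
move=> mA.
have mf : measurable_fun setT ((fun x => x + c) : measurableTypeR R -> measurableTypeR R) by exact: measurable_funD.
pose f : {mfun _ >-> _} := HB.pack ((fun x => x + c) : measurableTypeR R -> measurableTypeR R) (isMeasurableFun.Build _ _ _ _ _ mf).
apply/esym; apply: (@lebesgue_measure_unique _ (pushforward mu f)) => //= _ [[a b]] _ <-.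
rewrite /pushforward/=.
have -> : f @^-1` `]a, b] = `]a - c, b - c]%classic.
  by apply/seteqP; split=> x /=; rewrite !in_itv/= ltrBlDr lerBrDr.
by rewrite !lebesgue_measure_itv/= !lte_fin ltrD2r -!EFinB; case: ifP => // _; congr (_%:E); ring.
Qed.

Lemma normal_prob_shift (m s c : R) (B : set R) : measurable B ->
  normal_prob m s [set x | B (x + c)] =
  (\int[mu]_(z in B) (normal_pdf m s (z - c))%:E)%E.
Proof.
move=> mB; rewrite /normal_prob.
have mf : measurable_fun setT ((fun x => x + c) : measurableTypeR R -> measurableTypeR R) by exact: measurable_funD.
transitivity (\int[pushforward mu ((fun x => (x + c)%R) : measurableTypeR R -> measurableTypeR R)]_(z in B) (normal_pdf m s (z - c))%:E)%E.
  rewrite ge0_integral_pushforward//.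
  - by apply: eq_integral => x _ /=; rewrite addrK.
  - apply/measurable_EFinP; apply: measurable_funTS.
    apply: measurableT_comp; first exact: measurable_normal_pdf.
    exact: measurable_funB.
  - by move=> x _; rewrite lee_fin normal_pdf_ge0.
pose f : {mfun _ >-> _} := HB.pack ((fun x => x + c) : measurableTypeR R -> measurableTypeR R) (isMeasurableFun.Build _ _ _ _ _ mf).
apply: (@eq_measure_integral _ _ _ _ _ (pushforward mu f)) => A mA _.
exact: lebesgue_measure_shift.
Qed.

Lemma normal_prob_opp (s : R) (B : set R) : s != 0 -> measurable B ->
  normal_prob 0 s [set x | B (- x)] = normal_prob 0 s B.
Proof.
move=> s0 mB; rewrite /normal_prob.
have mf : measurable_fun setT (-%R : measurableTypeR R -> measurableTypeR R) by [].
transitivity (\int[pushforward mu (-%R : measurableTypeR R -> measurableTypeR R)]_(z in B) (normal_pdf 0 s (- z))%:E)%E.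
  rewrite ge0_integral_pushforward//.
  - by apply: eq_integral => x _ /=; rewrite opprK.
  - apply/measurable_EFinP; apply: measurable_funTS.
    by apply: measurableT_comp; first exact: measurable_normal_pdf.
  - by move=> x _; rewrite lee_fin normal_pdf_ge0.
pose f : {mfun _ >-> _} := HB.pack (-%R : measurableTypeR R -> measurableTypeR R) (isMeasurableFun.Build _ _ _ _ _ mf).
rewrite (@eq_measure_integral _ _ _ _ mu (pushforward mu f)).
  apply: eq_integral => x _; congr (_%:E).
  by rewrite !normal_pdfE// /normal_fun !subr0 sqrrN.
by move=> A mA _; exact: lebesgue_measureN.
Qed.

(** The change of variables is stated for the Radon-Nikodym derivative, which equals the density
    almost everywhere because both have the same integral over every measurable set. *)
Lemma ge0_integral_normal_prob (m s : R) (f : R -> \bar R) :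
  measurable_fun setT f -> (forall x, 0 <= f x)%E ->
  (\int[normal_prob m s]_x f x = \int[mu]_x (f x * (normal_pdf m s x)%:E))%E.
Proof.
move=> mf f0.
have dom := normal_prob_dominates m s.
rewrite -(Radon_Nikodym_SigmaFinite.change_of_variables dom)//.
have intg := Radon_Nikodym_SigmaFinite.f_integrable dom.
have mpdf : measurable_fun setT (fun x => (normal_pdf m s x)%:E).
  by apply/measurable_EFinP; exact: measurable_normal_pdf.
apply: ae_eq_integral => //.
- by apply: emeasurable_funM => //; exact: (measurable_int _ intg).
- exact: emeasurable_funM.
- apply: ae_eqe_mul2l; apply: integral_ae_eq => //.
  by move=> E _ mE; rewrite -Radon_Nikodym_SigmaFinite.f_integral.
Qed.

(** Completing the square: the joint density of z = A + c x and x, for A of deviation a, is the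
    marginal of z times the conditional density of x given z, of mean c z / s^2 and deviation a /
    s. *)
Lemma gauss_product (a c z x : R) : a != 0 ->
  let s := Num.sqrt (a ^+ 2 + c ^+ 2) in
  normal_pdf 0 a (z - c * x) * normal_pdf 0 1 x =
  normal_pdf 0 s z * normal_pdf (c * z / s ^+ 2) (a / s) x.
Proof.
move=> a0 s.
have a2 : 0 < a ^+ 2 by rewrite exprn_even_gt0.
have s2E : s ^+ 2 = a ^+ 2 + c ^+ 2 by rewrite sqr_sqrtr// addr_ge0 ?sqr_ge0.
have s2 : 0 < s ^+ 2 by rewrite s2E ltr_wpDr ?sqr_ge0.
have s0 : s != 0 by move: s2; rewrite exprn_even_gt0.
rewrite !normal_pdfE ?oner_eq0//; last by rewrite mulf_neq0// invr_eq0.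
rewrite /normal_fun /normal_peak.
rewrite mulrACA [RHS]mulrACA; congr (_ * _).
  rewrite -!invfM; congr (_^-1).
  rewrite -!sqrtrM//; last 2 first.
    by rewrite mulrn_wge0// mulr_ge0 ?sqr_ge0 ?pi_ge0.
    by rewrite mulrn_wge0// mulr_ge0 ?sqr_ge0 ?pi_ge0.
  by congr Num.sqrt; rewrite expr1n expr_div_n; field.
rewrite -!expRD; congr expR.
rewrite expr_div_n s2E; field.
by rewrite a0/= -s2E gt_eqF.
Qed.

(** After Tonelli the inner integral over t is that of the conditional density of [gauss_product],
    which is 1. *)
Lemma normal_convolution (a c : R) (B : set R) : a != 0 -> measurable B ->
  (\int[normal_prob 0 1]_t normal_prob 0 a [set y | B (y + c * t)%R] =
   normal_prob 0 (Num.sqrt (a ^+ 2 + c ^+ 2)) B)%E.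
Proof.
move=> a0 mB; set s := Num.sqrt _.
pose F (p : measurableTypeR R * measurableTypeR R) : \bar R :=
  (\1_B p.2 * normal_pdf 0 a (p.2 - c * p.1) * normal_pdf 0 1 p.1)%:E.
have mF : measurable_fun setT F.
  apply/measurable_EFinP; apply: measurable_funM; first apply: measurable_funM.
  - by apply: measurableT_comp => //; exact: measurable_indic.
  - apply: measurableT_comp; first exact: measurable_normal_pdf.
    by apply: measurable_funB => //; exact: measurable_funM.
  - by apply: measurableT_comp; first exact: measurable_normal_pdf.
have F0 p : (0 <= F p)%E by rewrite lee_fin !mulr_ge0// normal_pdf_ge0.
have gE t : normal_prob 0 a [set y | B (y + c * t)%R] =
   (\int[mu]_z (\1_B z * normal_pdf 0 a (z - c * t))%:E)%E.
  rewrite normal_prob_shift// integral_mkcond; apply: eq_integral => z _.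
  by rewrite patchE indicE; case: ifP; rewrite ?mul1r ?mul0r.
have mpa t : measurable_fun setT (fun z : measurableTypeR R => (\1_B z * normal_pdf 0 a (z - c * t))%:E).
  apply/measurable_EFinP; apply: measurable_funM; first exact: measurable_indic.
  by apply: measurableT_comp; [exact: measurable_normal_pdf|exact: measurable_funB].
rewrite ge0_integral_normal_prob//; last first.
  have -> : (fun t => normal_prob 0 a [set y | B (y + c * t)%R]) =
      fubini_F mu (fun p : measurableTypeR R * measurableTypeR R => (\1_B p.2 * normal_pdf 0 a (p.2 - c * p.1))%:E).
    by apply/funext => t; rewrite gE.
  apply: measurable_fun_fubini_tonelli_F; last first.
    by move=> p; rewrite lee_fin mulr_ge0// normal_pdf_ge0.
  apply/measurable_EFinP; apply: measurable_funM.
    by apply: measurableT_comp => //; exact: measurable_indic.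
  apply: measurableT_comp; first exact: measurable_normal_pdf.
  by apply: measurable_funB => //; exact: measurable_funM.
transitivity (\int[mu]_t \int[mu]_z F (t, z))%E.
  apply: eq_integral => t _; rewrite gE -ge0_integralZr//.
  - by move=> z _; rewrite lee_fin mulr_ge0// normal_pdf_ge0.
  - by rewrite lee_fin normal_pdf_ge0.
rewrite (@fubini_tonelli _ _ _ _ _ mu mu F)//.
rewrite /normal_prob [RHS]integral_mkcond; apply: eq_integral => z _.
rewrite patchE /F/= indicE; case: ifP => _; last first.
  by apply: integral0_eq => t _; rewrite !mul0r.
under eq_integral do rewrite mul1r gauss_product// EFinM.
rewrite ge0_integralZl//.
- by rewrite integral_normal_pdf mule1.
- by apply/measurable_EFinP; exact: measurable_normal_pdf.
- by move=> t _; rewrite lee_fin normal_pdf_ge0.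
- by rewrite lee_fin normal_pdf_ge0.
Qed.

End Gauss.

Section GaussBounds.
Context {R : realType}.
Local Notation mu := (@lebesgue_measure R).

Lemma normal_peak1_le : normal_peak 1 <= 1 / 2 :> R.
Proof.
have pi0 := @pi_gt0 R.
rewrite /normal_peak expr1n mul1r div1r lef_pV2 ?posrE ?sqrtr_gt0//; last first.
  by rewrite -mulr_natr; lra.
rewrite -[leLHS]ger0_norm// -sqrtr_sqr ler_wsqrtr// -mulr_natr.
have := @pi_ge2 R; lra.
Qed.

Lemma normal_peak_lb (s : R) : 0 < s -> (3 * s)^-1 <= normal_peak s.
Proof.
move=> s0; have pi0 := @pi_gt0 R.
rewrite /normal_peak lef_pV2 ?posrE ?mulr_gt0//; last first.
  by rewrite sqrtr_gt0 -mulr_natr !mulr_gt0// exprn_gt0.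
rewrite -[leRHS]ger0_norm; last by rewrite mulr_ge0// ltW.
rewrite -sqrtr_sqr ler_wsqrtr// exprMn -mulrnAr mulrC ler_wpM2r ?sqr_ge0//.
have := @pihalf_lt2 R; rewrite -mulr_natr; lra.
Qed.

(** The complement is an interval of length 1 on which the density is at most 1/2. *)
Lemma normal_prob_tail : ((1 / 2)%:E <= normal_prob 0 1 [set x : R | 1 / 2 <= `|x|]%R)%E.
Proof.
pose A : set R := `](- (1/2)), (1 / 2)[%classic.
have mA : measurable A by rewrite /A.
have -> : [set x : R | 1 / 2 <= `|x|]%R = ~` A.
  apply/seteqP; split=> x /=; rewrite /A/= in_itv/= -ltr_norml => h.
    by apply/negP; rewrite -leNgt.
  by move/negP : h; rewrite -leNgt.
rewrite probability_setC//.
have : (\int[mu]_(x in A) (normal_pdf 0 1 x)%:E <= \int[mu]_(x in A) (1/2)%:E)%E.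
  apply: ge0_le_integral => //.
  - by move=> x _; rewrite lee_fin normal_pdf_ge0.
  - by apply/measurable_EFinP/measurable_funTS; exact: measurable_normal_pdf.
  - move=> x _; rewrite lee_fin (le_trans (normal_pdf_ub _ _ _))// ?oner_eq0//.
    exact: normal_peak1_le.
rewrite integral_cst//= lebesgue_measure_itv/= lte_fin gtrN// -EFinB -EFinM.
set I := (\int[mu]_(x in A) _)%E => Ile.
have I0 : (0 <= I)%E by apply: integral_ge0 => x _; rewrite lee_fin normal_pdf_ge0.
have Ifin : I \is a fin_num by rewrite ge0_fin_numE// (le_lt_trans Ile)// ltry.
rewrite [X in (_ <= 1 - X)%E](_ : _ = I)// -(fineK Ifin) -EFinB lee_fin.
move: Ile; rewrite -{1}(fineK Ifin) lee_fin; lra.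
Qed.

(** On this interval of length 2 r one has |x| <= 1 + s / 2 <= 3 s / 2, so the exponent is at least
    - (3/2)^2 / 2 = - 9/8, and the peak is at least 1 / (3 s). *)
Lemma normal_prob_ball (s e r : R) : 1 <= s -> `|e| <= 1 -> 0 < r -> r <= s / 2 ->
  ((r * (2 / 3) * expR (- (9 / 8)) / s)%:E <= normal_prob 0 s [set x : R | `|x + e| <= r]%R)%E.
Proof.
move=> s1 e1 r0 rs.
have s0 : 0 < s by rewrite (lt_le_trans _ s1).
pose A : set R := `[(- e - r), (- e + r)]%classic.
have mA : measurable A by rewrite /A.
have -> : [set x : R | `|x + e| <= r]%R = A.
  apply/seteqP; split=> x /=; rewrite /A/= in_itv/= ler_norml => /andP[? ?]; apply/andP; split; lra.
rewrite /normal_prob.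
apply: (@le_trans _ _ (\int[mu]_(x in A) ((3 * s)^-1 * expR (- (9 / 8)))%:E)%E).
  rewrite integral_cst ?/A//= lebesgue_measure_itv/= lte_fin.
  have -> : (- e - r < - e + r) by lra.
  rewrite -EFinB -EFinM lee_fin le_eqVlt; apply/orP; left; apply/eqP.
  by field; rewrite gt_eqF.
apply: ge0_le_integral => //.
- by move=> x _; rewrite lee_fin mulr_ge0 ?expR_ge0// invr_ge0 mulr_ge0// ltW.
- by apply/measurable_EFinP/measurable_funTS; exact: measurable_normal_pdf.
- move=> x; rewrite /A/= in_itv/= => /andP[xl xr].
  rewrite lee_fin normal_pdfE ?gt_eqF//.
  apply: ler_pM; rewrite ?expR_ge0 ?normal_peak_lb//; first by rewrite invr_ge0 mulr_ge0// ltW.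
  rewrite /normal_fun ler_expR subr0 mulNr lerN2 ler_pdivrMr; last by rewrite mulrn_wgt0// exprn_gt0.
  move: e1; rewrite ler_norml => /andP[e1 e2].
  have xs : `|x| <= 3 / 2 * s by rewrite ler_norml; apply/andP; split; lra.
  rewrite -real_normK ?num_real// -mulr_natr.
  have : `|x| ^+ 2 <= (3 / 2 * s) ^+ 2 by rewrite lerXn2r// nnegrE// mulr_ge0// ltW.
  by rewrite exprMn; lra.
Qed.

(** Since 1/2 - 3/8 = 1/8 = 1 / (2 * 2^2), the integrand is twice the centred Gaussian density of
    deviation 2 s. *)
Lemma normal_exp_moment (s : R) : 0 < s ->
  (\int[normal_prob 0 s]_x (expR (3 / 8 * (x / s) ^+ 2))%:E = (2%R : R)%:E)%E.
Proof.
move=> s0.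
have mf : measurable_fun setT (fun x : R => (expR (3 / 8 * (x / s) ^+ 2))%:E).
  apply/measurable_EFinP; apply: measurableT_comp => //.
  apply: measurable_funM => //; apply: measurable_funX; exact: measurable_funM.
rewrite ge0_integral_normal_prob//.
transitivity (\int[mu]_x ((2%R : R)%:E * (normal_pdf 0 (2 * s) x)%:E))%E.
  apply: eq_integral => x _; rewrite -!EFinM; congr (_%:E).
  rewrite !normal_pdfE ?mulf_neq0 ?gt_eqF// mulrCA [RHS]mulrA /normal_fun -expRD.
  congr (_ * expR _).
    have E : Num.sqrt ((2 * s) ^+ 2 * pi *+ 2) = 2 * Num.sqrt (s ^+ 2 * pi *+ 2).
      by rewrite exprMn -mulrA -mulrnAr sqrtrM ?sqr_ge0// sqrtr_sqr ger0_norm.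
    by rewrite /normal_peak E invfM mulrA divff// mul1r.
  by rewrite !subr0; field; rewrite gt_eqF.
rewrite ge0_integralZl//.
- by rewrite integral_normal_pdf mule1.
- by apply/measurable_EFinP; exact: measurable_normal_pdf.
- by move=> x _; rewrite lee_fin normal_pdf_ge0.
Qed.

End GaussBounds.

Definition centered_normal {R : realType} {dT} {T : measurableType dT} (P : probability T R) (s : R) (A : T -> R) :=
  forall B, measurable B -> P (A @^-1` B) = normal_prob 0 s B.

(** * Linear combinations of independent Gaussians, and the ratio of a single row *)

Section Laws.
Context {R : realType} {dT : measure_display} {T : measurableType dT}.
Variables (P : probability T R) (K : finType) (Z : K -> T -> R).
Hypothesis mZ : forall k, measurable_fun setT (Z k).
Hypothesis indepZ : forall B : K -> set R, (forall k, measurable (B k)) ->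
  (P (\bigcap_k (Z k @^-1` B k)) = \prod_k P (Z k @^-1` B k))%E.
Implicit Types I J : {set K}.

Local Notation law := (centered_normal P).
Local Notation cs := (coarse Z).

Lemma ge0_integral_law (s : R) (A : T -> R) (f : R -> \bar R) :
  measurable_fun setT A -> law s A -> measurable_fun setT f -> (forall x, 0 <= f x)%E ->
  (\int[P]_x f (A x) = \int[normal_prob 0 s]_t f t)%E.
Proof.
move=> mA lA mf f0.
have mA' : measurable_fun setT (A : T -> measurableTypeR R) by [].
pose Am : {mfun T >-> measurableTypeR R} := HB.pack (A : T -> measurableTypeR R) (isMeasurableFun.Build _ _ _ _ _ mA').
rewrite -(@ge0_integral_distribution _ _ _ _ _ P Am f)//.
apply: (@eq_measure_integral _ _ _ setT (normal_prob 0 s) (distribution P Am)) => B mB _; exact: lA.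
Qed.

Let notin_set1 I k : k \notin I -> forall k', k' \in [set k]%SET -> k' \notin I.
Proof. by move=> kI k'; rewrite !inE => /eqP ->. Qed.

Let notin_set1' I k : k \notin I -> forall k', k' \in I -> k' \notin [set k]%SET.
Proof. by move=> kI k' k'I; rewrite !inE; apply: contraNneq kI => <-. Qed.

(** Freezing Z k leaves a Gaussian translated by c * Z k; averaging over Z k is the convolution. *)
Lemma law_add I (A : T -> R) (a c : R) (k : K) : k \notin I ->
  measurable_fun setT (A : cs I -> R) -> a != 0 -> law a A -> law 1 (Z k) ->
  law (Num.sqrt (a ^+ 2 + c ^+ 2)) (fun x => A x + c * Z k x).
Proof.
move=> kI mA a0 lA lZ B mB; rewrite -normal_convolution//.
pose E : set (cs [set k]%SET * cs I) := [set p | B (A p.2 + c * Z k p.1)].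
have mE : measurable E.
  have mf : measurable_fun setT (fun p : cs [set k]%SET * cs I => A p.2 + c * Z k p.1).
    apply: measurable_funD; first exact: measurableT_comp.
    apply: measurable_funM => //; apply: measurableT_comp => //.
    by apply: measurable_coord; rewrite inE.
  by rewrite -[E]setTI; exact: mf.
have := decoupling_prob mZ indepZ (notin_set1 kI) mE.
rewrite /E/= => ->.
pose g (t : R) := normal_prob 0 a [set y | B (y + c * t)].
transitivity (\int[P]_x g (Z k x))%E.
  apply: eq_integral => x _; rewrite /g -lA//.
  have mf : measurable_fun setT (fun y : measurableTypeR R => y + c * Z k x) by exact: measurable_funD.
  by rewrite -[X in measurable X]setTI; exact: mf.
rewrite (ge0_integral_law _ lZ)//.
pose E' : set (measurableTypeR R * measurableTypeR R) := [set p | B (p.2 + c * p.1)].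
have mE' : measurable E'.
  have mf : measurable_fun setT (fun p : measurableTypeR R * measurableTypeR R => p.2 + c * p.1).
    by apply: measurable_funD => //; exact: measurable_funM.
  by rewrite -[X in measurable X]setTI; exact: mf.
have -> : g = (normal_prob 0 a : probability (measurableTypeR R) R) \o xsection E'.
  by apply/funext => t; rewrite /g/=; congr (normal_prob _ _ _); apply/seteqP; split=> y; rewrite /xsection/= ?inE.
exact: measurable_fun_xsection.
Qed.

(** The summand A0 of variance 1 keeps all partial sums nondegenerate, as [law_add] requires, even
    where the coefficients vanish. *)
Lemma law_sum I0 (A0 : T -> R) (X : eqType) (s : seq X) (g : X -> K) (c : X -> R) :
  measurable_fun setT (A0 : cs I0 -> R) -> law 1 A0 ->
  uniq (map g s) -> (forall i, i \in s -> g i \notin I0) -> (forall i, i \in s -> law 1 (Z (g i))) ->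
  law (Num.sqrt (1 + \sum_(i <- s) c i ^+ 2)) (fun x => A0 x + \sum_(i <- s) c i * Z (g i) x).
Proof.
move=> mA0 lA0; elim: s => [|i s IH] /= us gI lg.
  rewrite big_nil addr0 sqrtr1.
  by under [X in law _ X]eq_fun do rewrite big_nil addr0.
case/andP: us => is_ us.
have sq0 : 0 <= \sum_(j <- s) c j ^+ 2 by apply: sumr_ge0 => j _; exact: sqr_ge0.
have lA := IH us (fun j js => gI j (mem_behead (s := i :: s) js)) (fun j js => lg j (mem_behead (s := i :: s) js)).
pose I1 := (I0 :|: [set k in map g s])%SET.
have sE : Num.sqrt (1 + \sum_(j <- i :: s) c j ^+ 2) =
    Num.sqrt ((Num.sqrt (1 + \sum_(j <- s) c j ^+ 2)) ^+ 2 + c i ^+ 2).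
  rewrite big_cons [X in _ = Num.sqrt (X + _)]sqr_sqrtr; last by rewrite addr_ge0.
  by rewrite -addrA [c i ^+ 2 + _]addrC.
have fE : (fun x => A0 x + \sum_(j <- i :: s) c j * Z (g j) x) =
    (fun x => (A0 x + \sum_(j <- s) c j * Z (g j) x) + c i * Z (g i) x).
  by apply/funext => x; rewrite big_cons -addrA [c i * _ + _]addrC.
rewrite sE fE; apply: (@law_add I1).
- rewrite !inE negb_or is_ andbT; apply: gI; rewrite inE eqxx//.
- apply: measurable_funD.
      by apply: (@measurable_coarse_sub _ _ _ _ Z I0) => //; exact: finset.subsetUl.
    apply: measurable_sum_seq => j js.
    apply: measurable_funM => //.
    by apply: measurable_coord; rewrite !inE map_f ?orbT.
- by rewrite gt_eqF// sqrtr_gt0 ltr_wpDr.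
- exact: lA.
- by apply: lg; rewrite inE eqxx.
Qed.

Lemma law_sign (sg : R) (k : K) : sg ^+ 2 = 1 -> law 1 (Z k) -> law 1 (fun x => sg * Z k x).
Proof.
move=> /eqP; rewrite sqrf_eq1 => /orP[/eqP ->|/eqP ->] lk B mB.
  by rewrite -lk//; congr (P _); apply/seteqP; split=> x /=; rewrite mul1r.
rewrite -[RHS]normal_prob_opp ?oner_eq0// -lk//; last first.
  have mf : measurable_fun setT (-%R : measurableTypeR R -> measurableTypeR R) by [].
  by rewrite -[X in measurable X]setTI; exact: mf.
by congr (P _); apply/seteqP; split=> x /=; rewrite mulN1r.
Qed.

Section Row.
Variables (I : {set K}) (k : K) (A : T -> R) (s e : R).
Hypotheses (kI : k \notin I) (mA : measurable_fun setT (A : cs I -> R)).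
Hypotheses (lA : law s A) (lk : law 1 (Z k)).

(** With A frozen this is the symmetry of the law of Z k. For a voting set E it exchanges the ratios
    above r with those below -r. *)
Lemma row_symmetry (E : set (R * R)) : measurable E ->
  P [set x | E (A x, Z k x)] = P [set x | E (A x, - Z k x)].
Proof.
move=> mE.
have mE1 : measurable ([set p | E (A p.1, Z k p.2)] : set (cs I * cs [set k]%SET)).
  have mf : measurable_fun setT (fun p : cs I * cs [set k]%SET => (A p.1, Z k p.2)).
    apply: measurable_fun_pair; apply: measurableT_comp => //.
    by apply: measurable_coord; rewrite inE.
  by rewrite -[X in measurable X]setTI; exact: mf.
have mE2 : measurable ([set p | E (A p.1, - Z k p.2)] : set (cs I * cs [set k]%SET)).
  have mf : measurable_fun setT (fun p : cs I * cs [set k]%SET => (A p.1, - Z k p.2)).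
    apply: measurable_fun_pair; first exact: measurableT_comp.
    apply: measurable_funN; apply: measurableT_comp => //.
    by apply: measurable_coord; rewrite inE.
  by rewrite -[X in measurable X]setTI; exact: mf.
have := decoupling_prob mZ indepZ (notin_set1' kI) mE1.
have := decoupling_prob mZ indepZ (notin_set1' kI) mE2.
rewrite /= => -> ->; apply: eq_integral => x _.
have mEx : measurable [set t : R | E (A x, t)].
  have mf : measurable_fun setT (fun t : R => (A x, t)) by exact: measurable_fun_pair.
  by rewrite -[X in measurable X]setTI; exact: mf.
have -> : P [set y | E (A x, Z k y)] = normal_prob 0 1 [set t | E (A x, t)] by rewrite -lk.
have -> : P [set y | E (A x, - Z k y)] = normal_prob 0 1 [set t | E (A x, - t)].
  rewrite -lk//.
  have mf : measurable_fun setT (fun t : R => (A x, - t)).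
    by apply: measurable_fun_pair => //.
  by rewrite -[X in measurable X]setTI; exact: mf.
by rewrite -[in LHS]normal_prob_opp// oner_eq0.
Qed.

(** A numerator of size at most tau * s / 2 and a denominator of size at least 1/2 suffice, and
    these two events are independent. The factor 1/6 is 1/2 * 2/3 * 1/2. *)
Lemma row_mid (tau r : R) : 1 <= s -> `|e| <= 1 -> 0 < tau <= 1 -> tau * s <= r ->
  ((tau * expR (- (9 / 8)) / 6)%:E <=
   P [set x | (1 / 2 <= `|Z k x|)%R /\ (`|(A x + e) / Z k x| <= r)%R])%E.
Proof.
move=> s1 e1 /andP[t0 t1] tr.
have s0 : 0 < s by rewrite (lt_le_trans _ s1).
pose C1 := [set x | (`|A x + e| <= tau * s / 2)%R].
pose C2 := [set x | (1 / 2 <= `|Z k x|)%R].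
have mB1 : measurable ([set t : R | `|t + e| <= tau * s / 2] : set R).
  have mf : measurable_fun setT (fun t : R => `|t + e|) by apply: measurableT_comp => //; exact: measurable_funD.
  have := mf measurableT _ (@measurable_itv _ `]-oo, (tau * s / 2)]); rewrite setTI.
  by congr measurable; apply/seteqP; split=> x /=; rewrite in_itv.
have mB2 : measurable ([set t : R | 1 / 2 <= `|t|] : set R).
  have mf : measurable_fun setT (fun t : R => `|t|) by [].
  have := mf measurableT _ (@measurable_itv _ `[(1 / 2), +oo[); rewrite setTI.
  by congr measurable; apply/seteqP; split=> x /=; rewrite in_itv/= andbT.
have P1 : ((tau * s / 2 * (2 / 3) * expR (- (9 / 8)) / s)%:E <= P C1)%E.
  rewrite [P C1](lA mB1); apply: normal_prob_ball => //; first by rewrite divr_gt0// mulr_gt0.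
  by rewrite ler_pM2r// ler_piMl// ltW.
have P2 : ((1 / 2)%:E <= P C2)%E.
  by rewrite [P C2](lk mB2); exact: normal_prob_tail.
apply: (@le_trans _ _ (P (C1 `&` C2))).
  rewrite (@coarse_indep _ _ _ P K Z mZ indepZ I [set k]%SET)//.
  - apply: le_trans (lee_pmul _ _ P1 P2); rewrite ?lee_fin//; last first.
      rewrite !mulr_ge0 ?expR_ge0 ?invr_ge0//; exact: ltW.
    rewrite le_eqVlt; apply/orP; left; apply/eqP; field.
    by rewrite gt_eqF.
  - exact: notin_set1'.
  - by rewrite -[X in measurable X]setTI; exact: (mA measurableT mB1).
  - rewrite -[X in measurable X]setTI; apply: (@measurable_coord _ _ _ _ Z [set k]%SET k _ measurableT _ mB2).
    by rewrite inE.
have mAT := measurable_coarse_fun mZ mA.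
apply: le_measure; rewrite ?inE.
- apply: measurableI.
    by rewrite -[X in measurable X]setTI; exact: (mAT measurableT _ mB1).
  by rewrite -[X in measurable X]setTI; exact: (@mZ k measurableT _ mB2).
- have mf : measurable_fun setT (fun x => (Z k x, `|(A x + e) / Z k x|)).
    apply: measurable_fun_pair => //; apply: measurableT_comp => //.
    apply: measurable_funM; first exact: measurable_funD.
    by apply: measurableT_comp; first exact: measurable_inv.
  have := mf measurableT ([set t : R | 1 / 2 <= `|t|] `*` `]-oo, r]) (measurableX mB2 (measurable_itv _)).
  rewrite setTI; congr measurable; apply/seteqP; split=> x /=; rewrite in_itv//=.
- move=> x [/= h1 h2]; split => //.
  have Z0 : 0 < `|Z k x| by rewrite (lt_le_trans _ h2)// divr_gt0.
  rewrite normrM normfV ler_pdivrMr//.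
  apply: (le_trans h1); apply: (@le_trans _ _ (r * (1 / 2))); first lra.
  rewrite ler_wpM2l// (le_trans _ tr)// mulr_ge0//; exact: ltW.
Qed.

End Row.

End Laws.

(** * Concentration of votes *)

Section Vote.
Context {R : realType} {dT : measure_display} {T : measurableType dT}.
Variables (P : probability T R) (K : finType) (Z : K -> T -> R).
Hypothesis mZ : forall k, measurable_fun setT (Z k).
Hypothesis indepZ : forall B : K -> set R, (forall k, measurable (B k)) ->
  (P (\bigcap_k (Z k @^-1` B k)) = \prod_k P (Z k @^-1` B k))%E.
Local Notation cs := (coarse Z).

Lemma prob_fine (A : set T) : measurable A -> P A = (fine (P A))%:E.
Proof. by move=> mA; rewrite fineK// fin_num_measure. Qed.

Lemma prob_le_integral (E : set T) (f : T -> R) : measurable E ->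
  measurable_fun setT f -> (forall x, 0 <= f x) -> (forall x, E x -> 1 <= f x) ->
  (P E <= \int[P]_x (f x)%:E)%E.
Proof.
move=> mE mf f0 Ef; rewrite -[X in P X]setIT -integral_indic//.
apply: ge0_le_integral => //.
- by apply/measurable_EFinP; exact: measurable_indic.
- exact/measurable_EFinP.
- move=> x _; rewrite lee_fin indicE; case: (boolP (x \in E)) => //.
  by rewrite inE => /Ef.
Qed.

Lemma exists2_bigsetU (U : Type) (X : finType) (Q : pred X) (A : X -> set U) :
  [set x | exists2 i, Q i & A i x] = \big[setU/set0]_(i | Q i) A i.
Proof.
rewrite -bigcup_seq_cond; apply/seteqP; split=> x [i].
  by move=> Qi Aix; exists i => //=; rewrite mem_index_enum.
by move=> /= /andP[_ Qi] Aix; exists i.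
Qed.

Lemma measurable_exists2 d' (U : measurableType d') (X : finType) (Q : pred X) (A : X -> set U) :
  (forall i, Q i -> measurable (A i)) -> measurable [set x | exists2 i, Q i & A i x].
Proof. by move=> mA; rewrite exists2_bigsetU; exact: bigsetU_measurable. Qed.

Lemma union_bound (X : finType) (Q : pred X) (A : X -> set T) :
  (forall i, Q i -> measurable (A i)) ->
  (P [set x | exists2 i, Q i & A i x] <= \sum_(i | Q i) P (A i))%E.
Proof.
move=> mA; rewrite exists2_bigsetU.
suff : measurable (\big[setU/set0]_(i | Q i) A i) /\
    (P (\big[setU/set0]_(i | Q i) A i) <= \sum_(i | Q i) P (A i))%E by case.
elim/big_ind2 : _ => [|x1 x2 y1 y2 [m1 h1] [m2 h2]|i Qi].
- by rewrite measure0.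
- split; first exact: measurableU.
  by apply: (le_trans (measureU2 _ _ _)) => //; exact: leeD.
- by split; first exact: mA.
Qed.

Lemma prode_le (X : eqType) (s : seq X) (a : X -> \bar R) (b : X -> R) :
  (forall i, i \in s -> 0 <= a i <= (b i)%:E)%E ->
  (\prod_(i <- s) a i <= (\prod_(i <- s) b i)%:E)%E.
Proof.
move=> ab; suff : (0 <= \prod_(i <- s) a i <= (\prod_(i <- s) b i)%:E)%E by case/andP.
elim: s ab => [|i s IH] ab; first by rewrite !big_nil lexx lee_fin ler01.
rewrite !big_cons EFinM.
have /andP[a0 ab1] := ab i (mem_head _ _).
have /andP[s0 sb] : (0 <= \prod_(i <- s) a i <= (\prod_(i <- s) b i)%:E)%E.
  by apply: IH => j js; apply: ab; rewrite inE js orbT.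
by rewrite mule_ge0//= lee_pmul.
Qed.

(** Both bounds come from 1 + x <= expR x and expR l * expR (- l) = 1: expR l <= 1 / (1 - l) and
    expR (- l) <= 1 / (1 + l). *)
Lemma expR_half_bounds (l : R) : 0 <= l <= 1 / 2 ->
  expR l <= 1 + l + 2 * l ^+ 2 /\ expR (- l) <= 1 - l + l ^+ 2.
Proof.
move=> /andP[l0 l1]; have h1 := expR_ge1Dx l; have h2 := expR_ge1Dx (- l).
have e0 := expR_gt0 l.
have E : expR l * expR (- l) = 1 by rewrite -expRD subrr expR0.
split.
- have : expR l * (1 - l) <= (1 + l + 2 * l ^+ 2) * (1 - l).
    apply: (@le_trans _ _ 1); first by rewrite -[leRHS]E ler_pM2l.
    nra.
  by rewrite ler_pM2r//; lra.
- have : expR (- l) * (1 + l) <= (1 - l + l ^+ 2) * (1 + l).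
    apply: (@le_trans _ _ 1); first by rewrite -[leRHS]E mulrC ler_wpM2r ?expR_ge0.
    have : 0 <= l ^+ 3 by rewrite exprn_ge0.
    by rewrite !exprS expr0; nra.
  by rewrite ler_pM2r//; lra.
Qed.

(** Second order expansion: the linear term is l (P A - P B) <= - l p, and the quadratic one is at
    most 2 l^2 (P A + P B) <= 2 l^2. *)
Lemma vote_mgf (A B : set T) (p l : R) : measurable A -> measurable B ->
  (forall x, A x -> ~ B x) -> (P A + p%:E <= P B)%E -> 0 <= l <= 1 / 2 ->
  (\int[P]_x (expR (l * (\1_A x - \1_B x)))%:E <= (expR (- l * p + 2 * l ^+ 2))%:E)%E.
Proof.
move=> mA mB AB pAB l01.
pose C := ~` (A `|` B).
have mAB : measurable (A `|` B) by exact: measurableU.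
have mC : measurable C by exact: measurableC.
have PU : P (A `|` B) = (P A + P B)%E.
  by rewrite measureU//; apply/seteqP; split=> x //= -[/AB].
have PC : P C = (1 - (P A + P B))%E by rewrite /C probability_setC// PU.
have mi D (c : R) : measurable D -> measurable_fun setT (fun x : T => (c * \1_D x)%:E).
  by move=> mD; apply/measurable_EFinP; apply: measurable_funM => //; exact: measurable_indic.
have il D (c : R) : measurable D -> 0 <= c -> (\int[P]_x (c * \1_D x)%:E = c%:E * P D)%E.
  move=> mD c0; rewrite -[X in P X]setIT -integral_indic//.
  rewrite -ge0_integralZl//.
  by apply/measurable_EFinP; exact: measurable_indic.
have -> : (\int[P]_x (expR (l * (\1_A x - \1_B x)))%:E =
    (1%:E * P C + (expR l)%:E * P A) + (expR (- l))%:E * P B)%E.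
  rewrite -!il ?expR_ge0// -!ge0_integralD//;
    try (by move=> x _; rewrite -?EFinD lee_fin ?addr_ge0 ?mulr_ge0 ?expR_ge0);
    try (by apply: emeasurable_funD; exact: mi); try exact: mi.
  apply: eq_integral => x _; rewrite -!EFinD; congr (_%:E).
  rewrite !indicE /C in_setC in_setU.
  case: (boolP (x \in A)) => xA; case: (boolP (x \in B)) => xB /=.
  - by exfalso; move: xA xB; rewrite !inE => /AB.
  - by rewrite subr0 !mulr1 !mulr0 addr0 add0r.
  - by rewrite sub0r mulrN1 !mulr0 mulr1 !add0r.
  - by rewrite subrr mulr0 expR0 !mulr0 !addr0 mulr1.
rewrite PC; move: pAB.
rewrite (prob_fine mA) (prob_fine mB).
have := probability_le1 P mAB; rewrite PU (prob_fine mA) (prob_fine mB) -EFinD lee_fin.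
have : 0 <= fine (P A) by exact: fine_ge0.
have : 0 <= fine (P B) by exact: fine_ge0.
set a := fine (P A); set b := fine (P B) => b0 a0 ab1.
rewrite -EFinD lee_fin => pab.
rewrite -EFinB -!EFinM -!EFinD lee_fin mul1r.
have [e1 e2] := expR_half_bounds l01.
apply: le_trans (expR_ge1Dx _).
have h1 : expR l * a <= (1 + l + 2 * l ^+ 2) * a by rewrite ler_wpM2r.
have h2 : expR (- l) * b <= (1 - l + l ^+ 2) * b by rewrite ler_wpM2r.
case/andP: l01 => l0 l1.
rewrite /= in pab *.
have h3 : l * p <= l * (b - a) by rewrite ler_wpM2l//; lra.
have h4 : 2 * l ^+ 2 * (a + b) <= 2 * l ^+ 2 * 1 by rewrite ler_wpM2l// mulr_ge0// sqr_ge0.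
have h5 : 0 <= l ^+ 2 * b by rewrite mulr_ge0// sqr_ge0.
lra.
Qed.

(** Chernoff's method: if the votes for B do not outnumber those for A, the product of the [f i] is
    at least 1, and its mean factorizes over the disjoint groups. A row with p i = 0 costs only the
    quadratic term. *)
Lemma vote (X : eqType) (s : seq X) (G : X -> {set K}) (A B : X -> set T) (p : X -> R) (l : R) :
  uniq s -> (forall i j, i \in s -> j \in s -> i != j -> forall k, k \in G i -> k \notin G j) ->
  (forall i, i \in s -> measurable (A i : set (cs (G i)))) ->
  (forall i, i \in s -> measurable (B i : set (cs (G i)))) ->
  (forall i, i \in s -> forall x, A i x -> ~ B i x) ->
  (forall i, i \in s -> (P (A i) + (p i)%:E <= P (B i))%E) -> 0 <= l <= 1 / 2 ->
  (P [set x | \sum_(i <- s) \1_(B i) x <= \sum_(i <- s) \1_(A i) x :> R]%R <=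
   (expR (\sum_(i <- s) (- l * p i + 2 * l ^+ 2)))%:E)%E.
Proof.
move=> us dis mA mB AB pAB l01.
have mA' i : i \in s -> measurable (A i) by move=> /mA; exact: coarse_measurable.
have mB' i : i \in s -> measurable (B i) by move=> /mB; exact: coarse_measurable.
pose f i x := expR (l * (\1_(A i) x - \1_(B i) x)).
have mf i : i \in s -> measurable_fun setT (f i : cs (G i) -> R).
  move=> is_; apply: measurableT_comp => //; apply: measurable_funM => //.
  by apply: measurable_funB; apply: measurable_indic; [exact: mA|exact: mB].
have f0 i x : 0 <= f i x by exact: expR_ge0.
have msum (C : X -> set T) : (forall i, i \in s -> measurable (C i)) ->
    measurable_fun setT (fun x => \sum_(i <- s) \1_(C i) x : R).
  move=> mC.
  apply: measurable_sum_seq => j js.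
  by apply: measurable_indic; exact: mC.
set E := (X in P X).
have mE : measurable E.
  exact: measurable_le_set (msum _ mB') (msum _ mA').
apply: (@le_trans _ _ (\int[P]_x (\prod_(i <- s) f i x)%:E)%E).
  apply: prob_le_integral => //.
  - apply: measurable_prod => i is_; exact: (measurable_coarse_fun mZ (mf i is_)).
  - by move=> x; exact: prodr_ge0.
  - move=> x; rewrite /E/= => BA.
    rewrite -expR_sum -mulr_sumr sumrB -expR0 ler_expR mulr_ge0 ?subr_ge0//.
    by case/andP: l01.
rewrite (indep_integral_prod mZ indepZ us dis mf f0).
rewrite expR_sum; apply: prode_le => i is_; apply/andP; split.
  by apply: integral_ge0 => x _; rewrite lee_fin.
by apply: vote_mgf; [exact: mA'|exact: mB'|exact: AB|exact: pAB|].
Qed.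

End Vote.

(** * Medians *)

Lemma indic_bool (R : realType) (T : Type) (Q : T -> bool) x :
  \1_([set y | Q y]) x = (Q x)%:R :> R.
Proof.
rewrite indicE; suff -> : (x \in [set y | Q y]) = Q x by [].
by apply/idP/idP; rewrite inE.
Qed.

Section Median.
Context {R : realType}.
Implicit Types (s : seq R) (a : R).

Lemma count_sort (p : pred R) s : count p (sort <=%R s) = count p s.
Proof. by apply/seq.permP; rewrite perm_sort. Qed.

(** For the lower median, lying above a takes a strict majority above a, whereas lying below a in
    [median_lt] takes only half of the entries. *)
Lemma lt_median a s : (0 < size s)%N ->
  (a < median s) = (2 * count (<= a)%R s < size s)%N.
Proof.
rewrite /median; set c := count _ s; set n := size s => n0.
have sz : size (sort <=%R s) = n by exact: size_sort.
have ct : count (<= a)%R (sort <=%R s) = c by exact: count_sort.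
apply/idP/idP => h.
  rewrite ltnNge; apply/negP => h2.
  suff : nth 0 (sort <=%R s) n.-1./2 <= a by rewrite leNgt h.
  by apply: nth_count_le; [exact: sort_le_sorted|rewrite [X in (_ < X)%N]ct; lia].
apply: nth_count_gt; [exact: sort_le_sorted|].
by rewrite [X in (X <= _ < _)%N]ct [X in (_ <= _ < X)%N]sz; lia.
Qed.

Lemma median_lt a s : (0 < size s)%N ->
  (median s < a) = (size s < (2 * count (< a)%R s).+1)%N.
Proof.
rewrite /median; set c := count _ s; set n := size s => n0.
have sz : size (sort <=%R s) = n by exact: size_sort.
have ct : count (< a)%R (sort <=%R s) = c by exact: count_sort.
apply/idP/idP => h.
  rewrite ltnNge; apply/negP => h2.
  suff : a <= nth 0 (sort <=%R s) n.-1./2 by rewrite leNgt h.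
  apply: nth_count_ge; [exact: sort_le_sorted|].
  by rewrite [X in (X <= _ < _)%N]ct [X in (_ <= _ < X)%N]sz; lia.
by apply: nth_count_lt; [exact: sort_le_sorted|rewrite [X in (_ < X)%N]ct; lia].
Qed.

Lemma sum_count (X : Type) (r : seq X) (M : pred X) (v : X -> R) (p : pred R) :
  \sum_(i <- r) (M i && p (v i))%:R = (count p [seq v i | i <- r & M i])%:R :> R.
Proof.
elim: r => [|i r IH]; first by rewrite big_nil.
by rewrite big_cons IH /=; case: (M i); rewrite ?add0r//= natrD.
Qed.

(** The weak inequality absorbs the rule for ties, and for an empty list both sums are 0, so the
    default value of the median does no harm. *)
Lemma lt_median_vote (X : Type) (r : seq X) (M : pred X) (v : X -> R) a :
  a < median [seq v i | i <- r & M i] ->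
  \sum_(i <- r) (M i && (v i <= a))%:R <= \sum_(i <- r) (M i && (a < v i))%:R :> R.
Proof.
rewrite (sum_count r M v (<= a)) (sum_count r M v (> a)); set s := map _ _.
have [s0|s0] := posnP (size s); first by rewrite (size0nil s0).
rewrite lt_median// => h; rewrite ler_nat.
have := count_predC (<= a)%R s; rewrite (@eq_count _ (predC (<= a)) (> a)); last by move=> x; rewrite /= ltNge.
by move: h; set c := count _ s; set c' := count _ s; set m := size s; lia.
Qed.

Lemma median_lt_vote (X : Type) (r : seq X) (M : pred X) (v : X -> R) a :
  median [seq v i | i <- r & M i] < a ->
  \sum_(i <- r) (M i && (a <= v i))%:R <= \sum_(i <- r) (M i && (v i < a))%:R :> R.
Proof.
rewrite (sum_count r M v (>= a)) (sum_count r M v (< a)); set s := map _ _.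
have [s0|s0] := posnP (size s); first by rewrite (size0nil s0).
rewrite median_lt// => h; rewrite ler_nat.
have := count_predC (< a)%R s; rewrite (@eq_count _ (predC (< a)) (>= a)); last by move=> x; rewrite /= leNgt.
by move: h; set c := count _ s; set c' := count _ s; set m := size s; lia.
Qed.

Lemma measurable_median d (T : measurableType d) (X : eqType) (r : seq X)
    (M : X -> T -> bool) (v : X -> T -> R) :
  (forall i, i \in r -> measurable [set x | M i x]) ->
  (forall i, i \in r -> measurable_fun setT (v i)) ->
  measurable_fun setT (fun x => median [seq v i x | i <- r & M i x]).
Proof.
move=> mM mv; apply: (measurability _ (RGenOInfty.measurableE R)) => // _ [_ [a ->] <-].
rewrite setTI.
pose N (x : T) : R := \sum_(i <- r) (M i x)%:R.
pose c (x : T) : R := \sum_(i <- r) (M i x && (v i x <= a))%:R.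
have msum (Q : X -> T -> bool) : (forall i, i \in r -> measurable [set x | Q i x]) ->
    measurable_fun setT (fun x => \sum_(i <- r) (Q i x)%:R : R).
  move=> mQ.
  apply: measurable_sum_seq => j jr.
  by under eq_fun do rewrite -indic_bool; apply: measurable_indic; exact: mQ.
have mN : measurable_fun setT N by exact: msum.
have mc : measurable_fun setT c.
  apply: msum => i ir; rewrite (_ : mkset _ = [set x | M i x] `&` [set x | v i x <= a]).
    by apply: measurableI; [exact: mM|apply: measurable_le_set => //; exact: mv].
  by apply/seteqP; split=> x /=; [move=> /andP[]|move=> [-> ->]].
pose L x := [seq v i x | i <- r & M i x].
have NE x : N x = (size (L x))%:R.
  rewrite /N -(count_predT (L x)) -(sum_count r (M^~ x) (v^~ x) predT).
  by apply: eq_bigr => i _; rewrite andbT.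
have cE x : c x = (count (<= a)%R (L x))%:R by exact: (sum_count r (M^~ x) (v^~ x) (<= a)).
(* The first set is the case of an empty list, whose median 0 exceeds a exactly when a < 0. *)
rewrite (_ : _ @^-1` _ = ([set x | N x <= 0] `&` (if a < 0 then setT else set0)) `|`
    [set x | 2 * c x < N x]).
  apply: measurableU; last by apply: measurable_lt_set => //; exact: measurable_funM.
  by apply: measurableI; [exact: measurable_le_set|case: ifP].
apply/seteqP; split=> x /=; rewrite in_itv/= andbT NE cE -natrM ltr_nat lern0 -/(L x).
- have [s0|s0] := posnP (size (L x)).
    by rewrite (size0nil s0) /median/= => ->; left.
  by rewrite lt_median// => h; right.
- case=> [[/eqP s0]|h].
    by rewrite (size0nil s0) /median/=; case: ifP.
  by rewrite lt_median//; apply: leq_trans h.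
Qed.

End Median.

(** * Sampling without replacement *)

Section Sampling.
Context {R : realType}.
Variable n : nat.
Implicit Types (B : {set 'I_n}) (A Q : seq 'I_n) (s : {perm 'I_n}).

Definition hits B A := \sum_(s : {perm 'I_n}) (all (fun q => s q \in B) A : nat).

Lemma hits_sym B A q q' : q \notin A -> q' \notin A -> hits B (q' :: A) = hits B (q :: A).
Proof.
move=> qA q'A; rewrite /hits (reindex_inj (mulgI (tperm q q'))) /=.
apply: eq_bigr => s _; congr (nat_of_bool (_ && _)).
  by rewrite permM tpermR.
apply: eq_in_all => p pA; rewrite permM tpermD//.
  by apply: contraNneq qA => ->.
by apply: contraNneq q'A => ->.
Qed.

(* By symmetry q may be averaged over the n - |A| points outside A. *)
Lemma hits_cons B A q : uniq (q :: A) ->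
  (n * hits B (q :: A) <= #|B| * hits B A)%N.
Proof.
move=> /andP[qA uA].
have cA : (size A + #|[predC A]| = n)%N.
  by have := cardC (mem A); rewrite (card_uniqP uA) card_ord.
have An : (size A < n)%N.
  have : (0 < #|[predC A]|)%N by apply/card_gt0P; exists q.
  by move: cA; lia.
(* A permutation that sends A into B sends exactly |B| - |A| of the points outside A into B. *)
have E : ((n - size A) * hits B (q :: A) = (#|B| - size A) * hits B A)%N.
  have : (\sum_(q' | q' \notin A) hits B (q' :: A) = (n - size A) * hits B (q :: A))%N.
    rewrite (eq_bigr (fun=> hits B (q :: A))); last by move=> q' q'A; exact: hits_sym.
    by rewrite sum_nat_const; congr (_ * _)%N; move: cA; rewrite -[X in _ -> X = _]/(#|[predC A]|); lia.
  move=> <-; rewrite /hits exchange_big/= [RHS]big_distrr/=; apply: eq_bigr => s _.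
  under eq_bigr do rewrite -mulnb.
  rewrite -big_distrl/=; case: (boolP (all _ A)) => h; last by rewrite !muln0.
  rewrite !muln1 -big_mkcondr/= sum1dep_card.
  have cB : #|[pred q' | s q' \in B]| = #|B|.
    rewrite -(card_imset _ (@perm_inj _ s^-1%g)) -[RHS]cardsE; apply: eq_card => x.
    rewrite !inE; apply/idP/imsetP => [xB|[y yB ->]].
      by exists (s x); rewrite ?permK//.
    by rewrite permKV.
  rewrite -cB -(cardID (mem A) [pred q' | s q' \in B]).
  have -> : #|[predI [pred q' | s q' \in B] & mem A]| = size A.
    rewrite -(card_uniqP uA); apply: eq_card => x; rewrite !inE.
    by apply: andb_idl => xA; exact: (allP h).
  by rewrite addKn; apply: eq_card => x; rewrite !inE.
have nA : (0 < n - size A)%N by rewrite subn_gt0.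
(* What remains is (|B| - |A|) / (n - |A|) <= |B| / n: earlier hits only make another one less
   likely. *)
rewrite -(leq_pmul2l nA) mulnCA E mulnCA mulnA [leqRHS]mulnA leq_mul2r; apply/orP; right.
have : (#|B| <= n)%N by rewrite -[n in (_ <= n)%N]card_ord max_card.
move: An; clear; move: #|B| (size A) => b a an bn.
have [ba|ab] := leqP b a; first by rewrite (eqP (_ : b - a == 0)%N) ?subn_eq0.
have [k bE] : exists k, b = (a + k)%N by exists (b - a)%N; lia.
have [l nE] : exists l, n = (a + l)%N by exists (n - a)%N; lia.
by rewrite nE bE !addKn; nia.
Qed.

Hypothesis n0 : (0 < n)%N.

(** Each factor is x + (1 - x) 1[s q in B]. The induction on Q moves q into A in the second term,
    and [hits_cons] bounds that term as for sampling with replacement. *)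
Lemma hits_bound B A Q (x : R) : uniq (A ++ Q) -> 0 <= x <= 1 ->
  \sum_(s : {perm 'I_n}) ((all (fun q => s q \in B) A)%:R *
     \prod_(q <- Q) (if s q \in B then 1 else x)) <=
  (hits B A)%:R * (x + (1 - x) * (#|B|%:R / n%:R)) ^+ size Q.
Proof.
move=> + /andP[x0 x1]; elim: Q A => [|q Q IH] A uAQ.
  rewrite expr0 mulr1 /hits natr_sum; apply: ler_sum => s _.
  by rewrite big_nil mulr1.
have [uA' qA qQA qQ uQ] : [/\ uniq A, q \notin A, ~~ has (mem A) Q, q \notin Q & uniq Q].
  by move: uAQ; rewrite cat_uniq /= negb_or => /and3P[-> /andP[-> ->] /andP[-> ->]].
have uA : uniq (q :: A) by rewrite /= qA.
have uAQ' : uniq (A ++ Q) by rewrite cat_uniq uA' qQA.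
have uqAQ : uniq ((q :: A) ++ Q) by rewrite /= cat_uniq mem_cat negb_or qA qQ uA' qQA.
have x1' : 0 <= 1 - x by rewrite subr_ge0.
rewrite (eq_bigr (fun s : {perm 'I_n} =>
    x * ((all (fun q => s q \in B) A)%:R * \prod_(q <- Q) (if s q \in B then 1 else x)) +
    (1 - x) * ((all (fun q => s q \in B) (q :: A))%:R * \prod_(q <- Q) (if s q \in B then 1 else x)))); last first.
  move=> s _; rewrite big_cons /=; case: (s q \in B) => /=; rewrite ?mul0r ?mulr0 ?addr0 ?mul1r; last by rewrite mulrCA.
  by rewrite -mulrDl addrC subrK mul1r.
rewrite big_split /= -!mulr_sumr exprS.
set y := x + _; have y0 : 0 <= y by rewrite addr_ge0// mulr_ge0// divr_ge0.
apply: (@le_trans _ _ (x * ((hits B A)%:R * y ^+ size Q) + (1 - x) * ((hits B (q :: A))%:R * y ^+ size Q))).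
  by rewrite lerD// ler_wpM2l//; [exact: IH|exact: (IH (q :: A))].
rewrite !mulrA -mulrDl ler_wpM2r ?exprn_ge0// /y mulrDr [_ * x]mulrC lerD2l mulrCA ler_wpM2l//.
rewrite mulrA ler_pdivlMr ?ltr0n// -!natrM ler_nat mulnC [leqRHS]mulnC.
exact: hits_cons.
Qed.

(** Each hit of G is weighted by x = e^(-1/2) <= 2/3, so the mean weight of m draws is at most exp
    (- alpha m / 3). On the event in question the weight exceeds exp (- alpha m / 4), and 1/3 - 1/4
    = 1/12. *)
Lemma sampling (G : {set 'I_n}) Q (alpha : R) : uniq Q ->
  0 <= alpha -> alpha * n%:R <= #|G|%:R ->
  (\sum_(s : {perm 'I_n} | ((count (fun q => s q \in G) Q)%:R < alpha * (size Q)%:R / 2)%R) 1%N)%:R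
   <= (n`!)%:R * expR (- (alpha * (size Q)%:R / 12)).
Proof.
move=> uQ a0 aG.
pose x : R := expR (- (1 / 2)).
have x0 : 0 < x by exact: expR_gt0.
have x23 : x <= 2 / 3.
  have := expR_ge1Dx (1 / 2 : R); have : x * expR (1 / 2) = 1 by rewrite -expRD addNr expR0.
  by move: (expR _) => y h1 h2; nra.
have x01 : 0 <= x <= 1 by apply/andP; split; lra.
have := @hits_bound (~: G)%SET [::] Q x uQ x01.
have -> : hits (~: G)%SET [::] = n`!.
  by rewrite /hits sum_nat_const muln1 -(card_Sn n); apply: eq_card.
set m := size Q.
have b1 : x + (1 - x) * (#|(~: G)%SET|%:R / n%:R) <= expR (- (alpha / 3)).
  have -> : #|(~: G)%SET|%:R / n%:R = 1 - #|G|%:R / n%:R :> R.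
    have : (#|G| + #|(~: G)%SET| = n)%N by rewrite cardsC card_ord.
    move=> cG; rewrite (_ : #|(~: G)%SET|%:R = n%:R - #|G|%:R) ?mulrBl ?divff ?pnatr_eq0 -?lt0n//.
    by apply/eqP; rewrite eq_sym subr_eq -natrD addnC cG.
  have : alpha <= #|G|%:R / n%:R by rewrite ler_pdivlMr// ltr0n.
  have := expR_ge1Dx (- (alpha / 3)); move: (#|G|%:R / n%:R) => g; nra.
move=> h.
have h2 : (n`!)%:R * (x + (1 - x) * (#|(~: G)%SET|%:R / n%:R)) ^+ m <= (n`!)%:R * expR (- (alpha * m%:R / 3)).
  rewrite ler_wpM2l// (_ : - (alpha * m%:R / 3) = - (alpha / 3) * m%:R); last by field.
  rewrite expRM_natr lerXn2r// ?nnegrE ?expR_ge0//.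
  by rewrite addr_ge0 ?(ltW x0)// mulr_ge0 ?divr_ge0//; lra.
rewrite -(@ler_pM2r _ (expR (- (alpha * m%:R / 4)))) ?expR_gt0//.
rewrite -[leRHS]mulrA -expRD (_ : - (alpha * m%:R / 12) + - (alpha * m%:R / 4) = - (alpha * m%:R / 3)); last by field.
apply: le_trans h2; apply: le_trans h.
rewrite natr_sum mulr_suml big_mkcond/=; apply: ler_sum => s _.
rewrite /= [leRHS]mul1r; case: ifP => h; last by apply: prodr_ge0 => q _; case: ifP => // _; exact: ltW.
rewrite mul1r.
have -> : \prod_(q <- Q) (if s q \in (~: G)%SET then 1 else x) = x ^+ count (fun q => s q \in G) Q.
  elim: (Q) => [|q Q' IH]; first by rewrite big_nil.
  by rewrite big_cons IH inE /=; case: (s q \in G); rewrite ?mul1r// exprS.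
by rewrite -expRM_natr ler_expR -/m; move: h; lra.
Qed.

End Sampling.

(** * The operator norm of a Gaussian matrix *)

Section Net.
Context {R : realType}.
Variables (n d : nat).
Hypothesis d0 : (0 < d)%N.
Local Notation N := (16 * d)%N.

(* Integer points; rounding the ball of radius sqrt N towards 0 moves by at most
   sqrt d, a quarter of the radius, and lands in the small points. *)
Definition grid := {ffun 'I_d -> 'I_(2 * N).+1}.
Definition coef (k : 'I_(2 * N).+1) : R := (k : nat)%:R - N%:R.
Definition small (z : grid) : bool := \sum_(j < d) coef (z j) ^+ 2 <= N%:R.

Lemma round_to_grid (u : R) : u ^+ 2 <= N%:R ->
  exists k, coef k ^+ 2 <= u ^+ 2 /\ (u - coef k) ^+ 2 <= 1.
Proof.
move=> uN; set t := Num.truncn `|u|.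
have /andP[t1 t2] : t%:R <= `|u| < t.+1%:R by exact: Num.Theory.truncn_itv.
have tge0 : 0 <= t%:R :> R by exact: ler0n.
have tN : (t <= N)%N.
  rewrite -(ler_nat R); apply: (le_trans t1).
  have : `|u| ^+ 2 <= N%:R ^+ 2.
    rewrite real_normK ?num_real// (le_trans uN)// -natrX ler_nat; nia.
  by rewrite ler_pXn2r// nnegrE.
have [u0|u0] := leP 0 u.
- have kN : (N + t < (2 * N).+1)%N by lia.
  exists (Ordinal kN); rewrite /coef/= natrD addrAC subrr add0r.
  move: t1 t2; rewrite ger0_norm// -natr1 => t1 t2; split; nra.
- have kN : (N - t < (2 * N).+1)%N by lia.
  exists (Ordinal kN); rewrite /coef/= natrB// addrAC subrr add0r.
  move: t1 t2; rewrite ltr0_norm// -natr1 => t1 t2; split; rewrite ?sqrrN ?opprK; nra.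
Qed.

(** Let M be the supremum of the form Q over the unit ball, finite by a crude bound. Scaling v by 4
    sqrt d gives z + r with z small and |r|^2 <= d, so that 16 d Q v <= 2 L + 2 M d. Hence M <= L /
    (8 d) + M / 8, which is solved for M. *)
Lemma net_bound (x : 'I_n -> 'I_d -> R) (L : R) : 0 <= L ->
  (forall z : grid, small z -> \sum_(i < n) (\sum_(j < d) x i j * coef (z j)) ^+ 2 <= L) ->
  forall v : 'I_d -> R, \sum_(i < n) (\sum_(j < d) x i j * v j) ^+ 2 <=
    L / (7 * d%:R) * \sum_(j < d) v j ^+ 2.
Proof.
move=> L0 netL.
pose Q (v : 'I_d -> R) := \sum_(i < n) (\sum_(j < d) x i j * v j) ^+ 2.
pose q (v : 'I_d -> R) := \sum_(j < d) v j ^+ 2.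
have Q0 v : 0 <= Q v by apply: sumr_ge0 => i _; exact: sqr_ge0.
have q0 v : 0 <= q v by apply: sumr_ge0 => i _; exact: sqr_ge0.
have qle v j : v j ^+ 2 <= q v.
  by rewrite /q (bigD1 j)//= lerDl; apply: sumr_ge0 => i _; exact: sqr_ge0.
have QZ c v : Q (fun j => c * v j) = c ^+ 2 * Q v.
  rewrite /Q mulr_sumr; apply: eq_bigr => i _; rewrite -exprMn mulr_sumr.
  by congr (_ ^+ 2); apply: eq_bigr => j _; rewrite mulrCA.
have qZ c v : q (fun j => c * v j) = c ^+ 2 * q v.
  by rewrite /q mulr_sumr; apply: eq_bigr => i _; rewrite -exprMn.
have QD a b : Q (fun j => a j + b j) <= 2 * Q a + 2 * Q b.
  rewrite /Q !mulr_sumr -big_split/=; apply: ler_sum => i _.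
  under eq_bigr do rewrite mulrDr.
  rewrite big_split/=; move: (\sum_(_ < _) _) (\sum_(_ < _) _) => y z.
  have := sqr_ge0 (y - z); nra.
pose A := [set Q v | v in [set v | q v <= 1]].
have hA : has_sup A.
  split.
    exists (Q (fun=> 0)), (fun=> 0) => //=.
    by rewrite /q big1// => j _; rewrite expr0n.
  exists (\sum_(i < n) (\sum_(j < d) `|x i j|) ^+ 2) => _ [v /= qv <-].
  apply: ler_sum => i _; rewrite -real_normK ?num_real//.
  rewrite lerXn2r ?nnegrE ?sumr_ge0//.
  apply: (le_trans (ler_norm_sum _ _ _)); apply: ler_sum => j _.
  rewrite normrM ler_piMr// -(@ler_pXn2r _ 2)// ?nnegrE// expr1n real_normK ?num_real//.
  exact: le_trans (qle _ _) qv.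
pose M := sup A.
have QM v : q v <= 1 -> Q v <= M by move=> qv; apply: sup_upper_bound => //; exists v.
have M0 : 0 <= M.
  apply: (le_trans (Q0 (fun=> 0))); apply: QM.
  by rewrite /q big1// => j _; rewrite expr0n.
have QMq v : Q v <= M * q v.
  have [qv0|qv0] := eqVneq (q v) 0.
    have v0 j : v j = 0.
      apply/eqP; rewrite -sqrf_eq0 eq_le sqr_ge0 andbT -qv0; exact: qle.
    rewrite qv0 mulr0 /Q big1// => i _; rewrite big1 ?expr0n// => j _.
    by rewrite v0 mulr0.
  have qvp : 0 < q v by rewrite lt_neqAle eq_sym qv0 q0.
  have := QM (fun j => (Num.sqrt (q v))^-1 * v j).
  rewrite QZ qZ exprVn sqr_sqrtr// mulVf// lexx => /(_ isT).
  by rewrite mulrC ler_pdivrMr.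
have dR : 0 < d%:R :> R by rewrite ltr0n.
suff ML : M <= L / (7 * d%:R).
  by move=> v; apply: (le_trans (QMq v)); rewrite ler_wpM2r.
have ball v : q v <= 1 -> Q v <= L / (8 * d%:R) + M / 8.
  move=> qv; pose u j := 4 * Num.sqrt d%:R * v j.
  have c2 : (4 * Num.sqrt d%:R) ^+ 2 = 16 * d%:R :> R.
    by rewrite exprMn sqr_sqrtr ?ler0n//; congr (_ * _); rewrite -natrX.
  have qu : q u <= N%:R by rewrite qZ c2 natrM ler_piMr// mulr_ge0.
  have /choice[z zP] : forall j, exists k, coef k ^+ 2 <= u j ^+ 2 /\ (u j - coef k) ^+ 2 <= 1.
    by move=> j; apply: round_to_grid; exact: le_trans (qle _ _) qu.
  have zs : small [ffun j => z j].
    apply: le_trans qu; apply: ler_sum => j _; rewrite ffunE; exact: (zP j).1.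
  have Qz : Q (fun j => coef (z j)) <= L.
    by have := netL _ zs; under eq_bigr do under eq_bigr do rewrite ffunE.
  pose r j := u j - coef (z j).
  have qr : q r <= d%:R.
    rewrite -[leRHS]mulr1 -[d in leRHS]card_ord mulr_natl -sumr_const.
    by apply: ler_sum => j _; exact: (zP j).2.
  have := QD (fun j => coef (z j)) r.
  rewrite (_ : (fun j => _ + r j) = u); last by apply/funext => j; rewrite /r addrC subrK.
  rewrite QZ c2.
  have := QMq r; have : M * q r <= M * d%:R by rewrite ler_wpM2l.
  move=> h1 h2 h3.
  have h4 : 16 * d%:R * Q v <= 2 * L + 2 * (M * d%:R) by lra.
  rewrite -(@ler_pM2l _ (16 * d%:R)) ?mulr_gt0//.
  rewrite [leRHS](_ : _ = 2 * L + 2 * (M * d%:R))//.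
  by field; rewrite gt_eqF.
have : M <= L / (8 * d%:R) + M / 8.
  by apply: ge_sup; [case: hA|move=> _ [v /= qv <-]; exact: ball].
have -> : L / (8 * d%:R) = (L / (7 * d%:R)) * (7 / 8) by field; rewrite gt_eqF.
lra.
Qed.

(** This is |k - N|: under truncated subtraction at most one of the two terms is nonzero. *)
Definition dist_mid (k : nat) : nat := ((k - N) + (N - k))%N.

Lemma coef_sqr (k : 'I_(2 * N).+1) : coef k ^+ 2 = (dist_mid k)%:R ^+ 2.
Proof.
rewrite /coef /dist_mid; have [kN|kN] := leqP k N.
  by rewrite (eqP (_ : k - N == 0)%N) ?subn_eq0// add0n natrB// -sqrrN opprB.
by rewrite (eqP (_ : N - k == 0)%N) ?subn_eq0 1?ltnW// addn0 natrB// ltnW.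
Qed.

Lemma sum_half m : \sum_(i < m) (2 : R) ^- i.+1 <= 1.
Proof.
suff -> : \sum_(i < m) (2 : R) ^- i.+1 = 1 - 2 ^- m by rewrite lerBlDr lerDl invr_ge0 exprn_ge0.
elim: m => [|m IH]; first by rewrite big_ord0 expr0 invr1 subrr.
rewrite big_ord_recr/= IH exprS invfM; field.
by rewrite expf_neq0.
Qed.

(** The middle index contributes 1 and each side a geometric sum of at most 1. *)
Lemma sum_dist : \sum_(k < (2 * N).+1) (2 : R) ^- dist_mid k <= 3.
Proof.
rewrite -(big_mkord xpredT (fun k => (2 : R) ^- dist_mid k)).
rewrite (@big_cat_nat _ _ _ N)//=; last by lia.
rewrite big_nat_recl/=; last by lia.
have -> : (\sum_(0 <= k < N) (2 : R) ^- dist_mid k) = \sum_(i < N) (2 : R) ^- i.+1.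
  rewrite big_nat_rev/= big_mkord; apply: eq_bigr => i _; congr (_ ^- _).
  by rewrite /dist_mid; have := ltn_ord i; lia.
have -> : \sum_(N <= i < 2 * N) (2 : R) ^- dist_mid i.+1 = \sum_(i < N) (2 : R) ^- i.+1.
  rewrite -{1}[N]add0n big_addn (_ : 2 * N - N = N)%N; last by lia.
  by rewrite big_mkord; apply: eq_bigr => i _; congr (_ ^- _); rewrite /dist_mid; lia.
have -> : dist_mid N = 0%N by rewrite /dist_mid; lia.
have := sum_half N; rewrite expr0 invr1; lra.
Qed.

(* Since |z_j| <= z_j^2, every small z satisfies 1 <= 2^N \prod_j 2^-|z_j|. *)
Lemma card_small : #|small|%:R <= (2 : R) ^+ (18 * d).
Proof.
rewrite -sum1_card natr_sum.
apply: (@le_trans _ _ (\sum_(z : grid) 2 ^+ N * \prod_(j < d) (2 : R) ^- dist_mid (z j))).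
  rewrite big_mkcond/=; apply: ler_sum => z _; case: ifP => zs; last first.
    by rewrite mulr_ge0 ?exprn_ge0// prodr_ge0// => j _; rewrite invr_ge0 exprn_ge0.
  have -> : \prod_(j < d) (2 : R) ^- dist_mid (z j) = 2 ^- (\sum_(j < d) dist_mid (z j)).
    by rewrite -prodrXr prodfV.
  rewrite -exprB ?unitfE//.
    by rewrite exprn_ege1// ler1n.
  rewrite -(ler_nat R); apply: le_trans zs; rewrite natr_sum; apply: ler_sum => j _.
  rewrite coef_sqr -natrX ler_nat; nia.
(* The sum over the whole grid factorizes into d sums of at most 3 <= 2^2, and 16 + 2 = 18. *)
rewrite -mulr_sumr -(bigA_distr_bigA (fun (j : 'I_d) (k : 'I_(2 * N).+1) => (2 : R) ^- dist_mid k))/=.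
apply: (@le_trans _ _ (2 ^+ N * 2 ^+ (2 * d))); last by rewrite -exprD -mulnDl.
rewrite ler_wpM2l ?exprn_ge0// exprM.
rewrite prodr_const card_ord lerXn2r// ?nnegrE.
- by apply: sumr_ge0 => k _; rewrite invr_ge0 exprn_ge0.
- by rewrite exprn_ge0.
- by apply: (le_trans sum_dist); rewrite -natrX ler_nat.
Qed.

End Net.

Section OpNorm.
Context {R : realType} {dT : measure_display} {T : measurableType dT}.
Variables (P : probability T R) (K : finType) (Z : K -> T -> R).
Hypothesis mZ : forall k, measurable_fun setT (Z k).
Hypothesis indepZ : forall B : K -> set R, (forall k, measurable (B k)) ->
  (P (\bigcap_k (Z k @^-1` B k)) = \prod_k P (Z k @^-1` B k))%E.
Variables (n d : nat) (kx : 'I_n -> 'I_d -> K) (kw : 'I_n -> K).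
Hypothesis kx_inj : forall i j i' j', kx i j = kx i' j' -> i = i' /\ j = j'.
Hypothesis kw_inj : injective kw.
Hypothesis kxw : forall i j i', kx i j != kw i'.
Hypothesis lx : forall i j, centered_normal P 1 (Z (kx i j)).
Hypothesis lw : forall i, centered_normal P 1 (Z (kw i)).
Hypothesis d0 : (0 < d)%N.
Hypothesis dn : (d <= n)%N.

(* The independent noise keeps the variance positive; it cancels in the
   difference with the point z = 0. *)
Let noisy (z : grid d) (i : 'I_n) (x : T) : R :=
  Z (kw i) x + \sum_(j < d) coef (z j) * Z (kx i j) x.

Let row_idx (i : 'I_n) : {set K} := (kw i |: [set kx i j | j in 'I_d])%SET.

Let scale (z : grid d) : R := Num.sqrt (1 + \sum_(j < d) coef (z j) ^+ 2).

Let bad (z : grid d) : set T :=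
  [set x | 56 * n%:R * (1 + \sum_(j < d) coef (z j) ^+ 2) < \sum_(i < n) noisy z i x ^+ 2].

Lemma row_disjoint i i' : i != i' -> forall k, k \in row_idx i -> k \notin row_idx i'.
Proof.
move=> ii' k; rewrite !inE => /orP[/eqP ->|/imsetP[j _ ->]]; rewrite negb_or; apply/andP; split.
- by apply: contraNneq ii' => /kw_inj ->.
- by apply/imsetP => -[j _ /esym/eqP]; rewrite (negbTE (kxw _ _ _)).
- exact: kxw.
- by apply/imsetP => -[j' _ /kx_inj[/eqP]]; rewrite (negbTE ii').
Qed.

Let measurable_noisy z i : measurable_fun setT (noisy z i : coarse Z (row_idx i) -> R).
Proof.
apply: measurable_funD; first by apply: measurable_coord; rewrite !inE eqxx.
apply: measurable_sum => j; apply: measurable_funM => //.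
by apply: measurable_coord; rewrite !inE imset_f ?orbT.
Qed.

Let law_noisy z i : centered_normal P (scale z) (noisy z i).
Proof.
apply: (@law_sum _ _ _ P K Z mZ indepZ [set kw i]%SET _ _ _ (kx i) (fun j => coef (z j))).
- by apply: measurable_coord; rewrite inE.
- exact: lw.
- by rewrite map_inj_uniq ?index_enum_uniq// => j j' /kx_inj[].
- by move=> j _; rewrite inE kxw.
- by move=> j _; exact: lx.
Qed.

Let measurable_bad z : measurable (bad z).
Proof.
apply: measurable_lt_set => //; apply: measurable_sum => i.
by apply: measurable_funX; exact: (measurable_coarse_fun mZ (@measurable_noisy z i)).
Qed.

Let scale_gt0 z : 0 < scale z.
Proof. by rewrite sqrtr_gt0 ltr_wpDr// sumr_ge0// => j _; exact: sqr_ge0. Qed.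

(** Markov's inequality for the exponential moment with parameter 3/8: each of the n independent
    rows contributes a factor 2, and the threshold 56 gives 21 = 3/8 * 56. *)
Let prob_bad z : (P (bad z) <= (2 ^+ n * expR (- (21 * n%:R)))%:E)%E.
Proof.
pose f i x := expR (3 / 8 * (noisy z i x / scale z) ^+ 2).
have mf i : measurable_fun setT (f i : coarse Z (row_idx i) -> R).
  apply: measurableT_comp => //; apply: measurable_funM => //; apply: measurable_funX.
  exact: measurable_funM.
have mfT i := measurable_coarse_fun mZ (mf i).
have I2 i : (\int[P]_x (f i x)%:E = (2%R : R)%:E)%E.
  rewrite -(normal_exp_moment (scale_gt0 z)).
  apply: (ge0_integral_law (A := noisy z i) (s := scale z) (f := fun t => (expR (3 / 8 * (t / scale z) ^+ 2))%:E)).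
  - exact: (measurable_coarse_fun mZ (@measurable_noisy z i)).
  - exact: law_noisy.
  - apply/measurable_EFinP; apply: measurableT_comp => //.
    by apply: measurable_funM => //; apply: measurable_funX; exact: measurable_funM.
  - by move=> r; rewrite lee_fin expR_ge0.
have prodE : (\int[P]_x (\prod_(i < n) f i x)%:E = (2 ^+ n)%:E)%E.
  rewrite (@indep_integral_prod _ _ _ P K Z mZ indepZ _ _ row_idx)//.
  - rewrite (eq_bigr (fun=> (2%R : R)%:E)); last by move=> i _; exact: I2.
    by rewrite prodEFin prodr_const card_ord.
  - exact: index_enum_uniq.
  - by move=> i j _ _; exact: row_disjoint.
  - by move=> i x; exact: expR_ge0.
pose g x : R := expR (- (21 * n%:R)) * \prod_(i < n) f i x.
apply: (@le_trans _ _ (\int[P]_x (g x)%:E)%E).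
  apply: prob_le_integral => //.
  - by apply: measurable_funM => //; apply: measurable_prod => i _.
  - by move=> x; rewrite mulr_ge0 ?expR_ge0// prodr_ge0// => i _; exact: expR_ge0.
  - move=> x; rewrite /bad/= /g => h; rewrite -expR_sum -expRD -[leLHS]expR0 ler_expR.
    rewrite -mulr_sumr; under eq_bigr do rewrite expr_div_n.
    rewrite -mulr_suml.
    have s2 : scale z ^+ 2 = 1 + \sum_(j < d) coef (z j) ^+ 2.
      by rewrite sqr_sqrtr// addr_ge0// sumr_ge0// => j _; exact: sqr_ge0.
    move: h; rewrite -s2 => h.
    have : 56 * n%:R <= (\sum_(i < n) noisy z i x ^+ 2) / scale z ^+ 2.
      by rewrite ler_pdivlMr ?exprn_gt0// ltW.
    by move: (_ / scale z ^+ 2) => y; lra.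
rewrite /g; under eq_integral do rewrite EFinM.
rewrite ge0_integralZl//.
- by rewrite prodE -EFinM mulrC.
- by apply/measurable_EFinP; apply: measurable_prod => i _.
- by move=> x _; rewrite lee_fin prodr_ge0// => i _; exact: expR_ge0.
Qed.

(** At most 2^(18 n) net points, each bad with probability at most 2^n e^(- 21 n), leave a total
    below e^(- n) because 2 <= e. The threshold 56 in [bad] is large enough to pay for the net. *)
Lemma opnorm_event : exists E : set T, [/\ measurable E,
  (P E <= (expR (- n%:R))%:E)%E &
  forall x, ~ E x -> forall v : 'I_d -> R,
    \sum_(i < n) (\sum_(j < d) Z (kx i j) x * v j) ^+ 2 <=
    8 * 68 * n%:R * \sum_(j < d) v j ^+ 2].
Proof.
have mU := measurable_exists2 (fun z (_ : @small R d z) => measurable_bad z).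
have PU := union_bound P (fun z (_ : @small R d z) => measurable_bad z).
eexists; split; first exact: mU.
- apply: (le_trans PU).
  apply: (@le_trans _ _ (\sum_(z : grid d | @small R d z) (2 ^+ n * expR (- (21 * n%:R)))%:E)%E).
    by apply: lee_sum => z _; exact: prob_bad.
  rewrite sumEFin lee_fin.
  have -> c : \sum_(z : grid d | @small R d z) c = #|@small R d|%:R * c :> R.
    by rewrite mulr_natl -sumr_const; apply: eq_bigl.
  have e2 : 2 <= expR 1 :> R by have := expR_ge1Dx (1 : R); lra.
  apply: (@le_trans _ _ (2 ^+ (18 * n) * (2 ^+ n * expR (- (21 * n%:R))))).
    rewrite ler_wpM2r ?mulr_ge0 ?exprn_ge0 ?expR_ge0//.
    have := (@card_small R d d0) => h; by apply: (le_trans h); rewrite ler_weXn2l ?ler1n// leq_mul2l dn orbT.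
  rewrite mulrA -exprD.
  have -> : expR (- n%:R) = expR 1 ^+ (18 * n + n) * expR (- (20 * n%:R)) :> R.
    by rewrite -expRM_natl -expRD; congr expR; rewrite natrD natrM; ring.
  apply: ler_pM; rewrite ?exprn_ge0 ?expR_ge0//; first by rewrite lerXn2r// ?nnegrE ?expR_ge0.
  by rewrite ler_expR lerN2 ler_wpM2r// ler_nat.
- move=> x Ex v.
  have good z : @small R d z -> \sum_(i < n) noisy z i x ^+ 2 <= 56 * n%:R * (1 + (16 * d)%:R).
    move=> zs; rewrite leNgt; apply/negP => h; apply: Ex; exists z => //.
    rewrite /bad/=; apply: le_lt_trans h; rewrite ler_wpM2l ?mulr_ge0// lerD2l.
    exact: zs.
  (* The grid index 16 d stands for the coordinate 0, so this is the origin, where [noisy] is the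
     bare noise. *)
  have small0 : @small R d [ffun=> inord (16 * d)].
    rewrite /small big1// => j _; rewrite ffunE /coef inordK; last by lia.
    by rewrite subrr expr0n.
  (* Subtracting the noise gives at most 4 * 56 n (1 + 16 d) <= 56 * 68 n d. *)
  have := @net_bound R n d d0 (fun i j => Z (kx i j) x) (56 * 68 * n%:R * d%:R).
  have -> : 56 * 68 * n%:R * d%:R / (7 * d%:R) = 8 * 68 * n%:R :> R.
    by field; rewrite pnatr_eq0 -lt0n.
  apply; first by rewrite !mulr_ge0 ?ler0n.
  move=> z zs.
  have g1 := good _ zs; have g0 := good _ small0.
  have h1 : \sum_(i < n) (\sum_(j < d) Z (kx i j) x * coef (z j)) ^+ 2 <=
      2 * (\sum_(i < n) noisy z i x ^+ 2) + 2 * (\sum_(i < n) noisy [ffun=> inord (16 * d)] i x ^+ 2).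
    rewrite !mulr_sumr -big_split/=; apply: ler_sum => i _.
    have -> : \sum_(j < d) Z (kx i j) x * coef (z j) = noisy z i x - noisy [ffun=> inord (16 * d)] i x.
      rewrite /noisy [X in _ - (_ + X)]big1 ?addr0; last first.
        by move=> j _; rewrite ffunE /coef inordK ?subrr ?mul0r//; lia.
      by rewrite addrAC subrr add0r; apply: eq_bigr => j _; rewrite mulrC.
    set a := noisy z i x; set b := noisy _ i x; rewrite -subr_ge0.
    have -> : 2 * a ^+ 2 + 2 * b ^+ 2 - (a - b) ^+ 2 = (a + b) ^+ 2 by ring.
    exact: sqr_ge0.
  apply: (le_trans h1).
  have d1 : 1 <= d%:R :> R by rewrite ler1n.
  have nR : 0 <= n%:R :> R by rewrite ler0n.
  have nd : n%:R * 1 <= n%:R * d%:R :> R by rewrite ler_wpM2l.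
  move: g1 g0; rewrite natrM.
  move: (\sum_(i < n) noisy z i x ^+ 2) (\sum_(i < n) noisy _ i x ^+ 2) => y1 y2; lra.
Qed.

End OpNorm.

(** * One round *)

(** The constant of [row_mid]: a row with |eta_i| <= 1 is biased by at least tau times this rate. *)
Definition vote_rate {R : realType} : R := expR (- (9 / 8)) / 6.

Lemma vote_rate_gt0 {R : realType} : 0 < vote_rate :> R.
Proof. by rewrite divr_gt0// expR_gt0. Qed.

Lemma vote_rate_le1 {R : realType} : vote_rate <= 1 :> R.
Proof.
have : expR (- (9 / 8)) <= 1 :> R by rewrite expR_le1; lra.
by rewrite /vote_rate; lra.
Qed.

Section Round.
Context {R : realType} {dT : measure_display} {T : measurableType dT}.
Variables (P : probability T R) (K : finType) (Z : K -> T -> R).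
Hypothesis mZ : forall k, measurable_fun setT (Z k).
Hypothesis indepZ : forall B : K -> set R, (forall k, measurable (B k)) ->
  (P (\bigcap_k (Z k @^-1` B k)) = \prod_k P (Z k @^-1` B k))%E.
Local Notation law := (centered_normal P).
Local Notation cs := (coarse Z).

Lemma measurable_vote_sets d' (T' : measurableType d') (f g : T' -> R) (r : R) :
  measurable_fun setT f -> measurable_fun setT g ->
  measurable [set x | (1 / 2 <= `|g x|) && (r < f x / g x)] /\
  measurable [set x | (1 / 2 <= `|g x|) && (f x / g x <= r)].
Proof.
move=> mf mg.
have mh : measurable_fun setT (fun x => f x / g x).
  by apply: measurable_funM => //; apply: (measurableT_comp measurable_inv).
have mn : measurable [set x | 1 / 2 <= `|g x|].
  by apply: measurable_le_set => //; apply: measurableT_comp.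
split.
- rewrite (_ : mkset _ = [set x | 1 / 2 <= `|g x|] `&` [set x | r < f x / g x]).
    by apply: measurableI => //; exact: measurable_lt_set.
  by apply/seteqP; split=> x /=; [move=> /andP[]|move=> [-> ->]].
- rewrite (_ : mkset _ = [set x | 1 / 2 <= `|g x|] `&` [set x | f x / g x <= r]).
    by apply: measurableI => //; exact: measurable_le_set.
  by apply/seteqP; split=> x /=; [move=> /andP[]|move=> [-> ->]].
Qed.

Section Row.
Variables (I : {set K}) (k : K) (A : T -> R) (s e : R).
Hypotheses (kI : k \notin I) (mA : measurable_fun setT (A : cs I -> R)).
Hypotheses (lA : law s A) (lk : law 1 (Z k)).

(** The ratios not above r split into those below -r and the middle ones. The former are as likely
    as those above r, so the middle is the bias. Negating the denominator gives the votes against -r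
    the same form. *)
Lemma row_votes (tau r : R) : 1 <= s -> 0 < tau <= 1 -> tau * s <= r ->
  let p := if `|e| <= 1 then tau * vote_rate else 0 in
  (P [set x | (1 / 2 <= `|Z k x|) && (r < (A x + e) / Z k x)]%R + p%:E <=
   P [set x | (1 / 2 <= `|Z k x|) && ((A x + e) / Z k x <= r)]%R)%E /\
  (P [set x | (1 / 2 <= `|Z k x|) && (r < (A x + e) / - Z k x)]%R + p%:E <=
   P [set x | (1 / 2 <= `|Z k x|) && ((A x + e) / - Z k x <= r)]%R)%E.
Proof.
move=> s1 t01 tr p.
have r0 : 0 <= r.
  by case/andP: t01 => t0 _; rewrite (le_trans _ tr)// mulr_ge0 ?(ltW t0)// (le_trans _ s1).
have mAe : measurable_fun setT (fun x => A x + e).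
  by apply: measurable_funD => //; exact: (measurable_coarse_fun mZ mA).
have mN : measurable_fun setT (fun x => - Z k x) by exact: measurable_funN.
pose Hi := [set x | (1 / 2 <= `|Z k x|) && (r < (A x + e) / Z k x)].
pose NHi := [set x | (1 / 2 <= `|Z k x|) && ((A x + e) / Z k x <= r)].
pose Lo := [set x | (1 / 2 <= `|Z k x|) && (r < (A x + e) / - Z k x)].
pose NLo := [set x | (1 / 2 <= `|Z k x|) && ((A x + e) / - Z k x <= r)].
pose Mid := [set x | (1 / 2 <= `|Z k x|)%R /\ (`|(A x + e) / Z k x| <= r)%R].
have [mHi mNHi] : measurable Hi /\ measurable NHi by exact: (measurable_vote_sets r mAe (mZ k)).
have [mLo mNLo] : measurable Lo /\ measurable NLo.
  have [] := measurable_vote_sets r mAe mN.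
  by rewrite /Lo /NLo; under eq_set do rewrite normrN; under [X in _ -> measurable X -> _]eq_set do rewrite normrN.
have NHiE : NHi = Lo `|` Mid.
  apply/seteqP; split=> x; rewrite /NHi /Lo /Mid/=.
    move=> /andP[-> h]; rewrite invrN mulrN.
    have [|h2] := ltP r (- ((A x + e) / Z k x)); first by left.
    by right; split=> //; rewrite ler_norml h andbT lerNl.
  case=> [/andP[-> h]|[-> h]]/=; last by move: h; rewrite ler_norml => /andP[].
  by move: h; rewrite invrN mulrN; lra.
have NLoE : NLo = Hi `|` Mid.
  apply/seteqP; split=> x; rewrite /NLo /Hi /Mid/= invrN mulrN.
    move=> /andP[-> h].
    have [|h2] := ltP r ((A x + e) / Z k x); first by left.
    by right; split=> //; rewrite ler_norml h2 andbT lerNl.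
  case=> [/andP[-> h]|[-> h]]/=; last by move: h; rewrite ler_norml => /andP[]; lra.
  by lra.
have mMid : measurable Mid.
  have -> : Mid = NHi `&` NLo.
    apply/seteqP; split=> x; rewrite /Mid /NHi /NLo/= invrN mulrN.
      by move=> [-> ]; rewrite ler_norml/= => /andP[h1 h2]; split=> //; lra.
    by move=> [/andP[-> h1] /andP[_ h2]]; split=> //; rewrite ler_norml h1 andbT; lra.
  exact: measurableI.
have HiLo : P Hi = P Lo.
  have mE : measurable [set q : R * R | (1 / 2 <= `|q.2|) && (r < (q.1 + e) / q.2)].
    have mf1 : measurable_fun setT (fun q : R * R => q.1 + e) by exact: measurable_funD.
    have mf2 : measurable_fun setT (fun q : R * R => q.2) by exact: measurable_snd.
    by have [] := measurable_vote_sets r mf1 mf2.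
  have := row_symmetry mZ indepZ kI mA lk mE.
  rewrite /= => ->; congr (P _); apply/seteqP; split=> x /=; rewrite normrN//.
have pM : (p%:E <= P Mid)%E.
  rewrite /p; case: ifP => [e1|_]; last by [].
  rewrite /vote_rate mulrA.
  exact: (row_mid mZ indepZ kI mA lA lk s1 e1 t01 tr).
have P1 : P NHi = (P Lo + P Mid)%E.
  rewrite NHiE measureU//; apply/seteqP; split=> x //=; rewrite /Lo /Mid/=.
  by move=> [/andP[_ h] [_]]; rewrite ler_norml => /andP[h1 h2]; move: h; rewrite invrN mulrN; lra.
have P2 : P NLo = (P Hi + P Mid)%E.
  rewrite NLoE measureU//; apply/seteqP; split=> x //=; rewrite /Hi /Mid/=.
  by move=> [/andP[_ h] [_]]; rewrite ler_norml => /andP[h1 h2]; lra.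
by rewrite P1 P2 HiLo; split; exact: leeD.
Qed.

End Row.

Section CoordinateMedian.
Variables (n d : nat) (kx : 'I_n -> 'I_d -> K) (kw : 'I_n -> K).
Hypothesis kx_inj : forall i j i' j', kx i j = kx i' j' -> i = i' /\ j = j'.
Hypothesis kw_inj : injective kw.
Hypothesis kxw : forall i j i', kx i j != kw i'.
Hypothesis lx : forall i j, law 1 (Z (kx i j)).
Hypothesis lw : forall i, law 1 (Z (kw i)).
Variables (b : 'I_d -> R) (sg eta : 'I_n -> R) (S : {set 'I_n}) (j : 'I_d).
Hypothesis sgS : forall i, i \in S -> sg i ^+ 2 = 1.

Let U (i : 'I_n) (x : T) : R :=
  sg i * Z (kw i) x + \sum_(l <- [seq l <- index_enum 'I_d | l != j]) b l * Z (kx i l) x.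

Let num (i : 'I_n) (x : T) : R := U i x + eta i.

Let value (i : 'I_n) (x : T) : R :=
  (sg i * (\sum_(l < d) Z (kx i l) x * b l + eta i) + Z (kw i) x) / (sg i * Z (kx i j) x).

(** As [sg i] is its own inverse, it cancels from the response and survives only in front of the
    noise. *)
Let valueE i x : i \in S -> 1 / 2 <= `|Z (kx i j) x| ->
  value i x = b j + num i x / Z (kx i j) x.
Proof.
move=> iS Zx; have s2 := sgS iS.
have Z0 : Z (kx i j) x != 0 by rewrite -normr_gt0 (lt_le_trans _ Zx)// divr_gt0.
have s0 : sg i != 0 by rewrite -sqrf_eq0 s2 oner_eq0.
have sV : (sg i)^-1 = sg i by apply: (mulfI s0); rewrite divff// -expr2 s2.
have E : \sum_(l < d) Z (kx i l) x * b l =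
    Z (kx i j) x * b j + \sum_(l <- [seq l <- index_enum 'I_d | l != j]) b l * Z (kx i l) x.
  rewrite (bigD1 j)//= big_filter; congr (_ + _); apply: eq_bigr => l _.
  by rewrite mulrC.
rewrite /value /num /U E; move: (\sum_(_ <- _) _) => V.
rewrite invfM sV [_ * (sg i * _)]mulrA mulrDl mulrAC -expr2 s2 mul1r.
by field.
Qed.

Let norm_sg i x : i \in S -> `|sg i * Z (kx i j) x| = `|Z (kx i j) x|.
Proof.
move=> iS; rewrite normrM; have -> : `|sg i| = 1; last by rewrite mul1r.
by apply/eqP; rewrite -sqrp_eq1// real_normK ?num_real// sgS.
Qed.

(** [idx] holds all sources of row i and separates distinct rows; [idx'] omits X_ij, so that the
    numerator is independent of the denominator. *)
Let idx (i : 'I_n) : {set K} := (kw i |: [set kx i l | l in 'I_d])%SET.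
Let idx' (i : 'I_n) : {set K} := (kw i |: [set kx i l | l in 'I_d & l != j])%SET.

Let measurable_U i : measurable_fun setT (U i : cs (idx' i) -> R).
Proof.
apply: measurable_funD.
  by apply: measurable_funM => //; apply: measurable_coord; rewrite !inE eqxx.
under eq_fun do rewrite big_filter big_mkcond.
apply: measurable_sum => l; have [->|lj] := eqVneq l j; first by exact: measurable_cst.
apply: measurable_funM => //; apply: measurable_coord; rewrite !inE; apply/orP; right.
by apply/imsetP; exists l => //; rewrite inE.
Qed.

Let law_U i : i \in S ->
  law (Num.sqrt (1 + \sum_(l <- [seq l <- index_enum 'I_d | l != j]) b l ^+ 2)) (U i).
Proof.
move=> iS.
apply: (@law_sum _ _ _ P K Z mZ indepZ [set kw i]%SET (fun x => sg i * Z (kw i) x) _ _ (kx i) b).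
- by apply: measurable_funM => //; apply: measurable_coord; rewrite inE.
- by apply: law_sign; [exact: sgS|exact: lw].
- rewrite map_inj_uniq; first by rewrite filter_uniq// index_enum_uniq.
  by move=> l l' /kx_inj[].
- by move=> l _; rewrite inE kxw.
- by move=> l _; exact: lx.
Qed.

Lemma coordinate_median_tail (tau r al : R) :
  0 < tau <= 1 -> 0 < al <= 1 -> tau * Num.sqrt (1 + \sum_(l < d) b l ^+ 2) <= r ->
  al * #|S|%:R / 2 <= #|[set i in S | `|eta i| <= 1]%SET|%:R ->
  (P [set x | r < `|cw_median S (fun i => \sum_(l < d) Z (kx i l) x * b l + eta i)
         (fun i l => Z (kx i l) x) (fun i => Z (kw i) x) sg j - b j|]%R <=
   (2 * expR (- ((tau * vote_rate * al) ^+ 2 * #|S|%:R / 32)))%:E)%E.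
Proof.
move=> t01 al01 tr good.
have s2 : 1 <= Num.sqrt (1 + \sum_(l <- [seq l <- index_enum 'I_d | l != j]) b l ^+ 2).
  rewrite -[leLHS]sqrtr1 ler_wsqrtr// lerDl sumr_ge0// => l _; exact: sqr_ge0.
have tr' : tau * Num.sqrt (1 + \sum_(l <- [seq l <- index_enum 'I_d | l != j]) b l ^+ 2) <= r.
  apply: le_trans tr; rewrite ler_wpM2l ?(ltW (proj1 (andP t01)))//.
  rewrite ler_wsqrtr// lerD2l big_filter [leRHS](bigD1 j)//= lerDr; exact: sqr_ge0.
have kj i : kx i j \notin idx' i.
  rewrite !inE negb_or kxw; apply/imsetP => -[l]; rewrite inE => lj /kx_inj[_ jl].
  by rewrite jl eqxx in lj.
pose p i := if `|eta i| <= 1 then tau * vote_rate else 0.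
pose A i := [set x | (1 / 2 <= `|Z (kx i j) x|) && (r < num i x / Z (kx i j) x)].
pose B i := [set x | (1 / 2 <= `|Z (kx i j) x|) && (num i x / Z (kx i j) x <= r)].
pose A' i := [set x | (1 / 2 <= `|Z (kx i j) x|) && (r < num i x / - Z (kx i j) x)].
pose B' i := [set x | (1 / 2 <= `|Z (kx i j) x|) && (num i x / - Z (kx i j) x <= r)].
have votes i : i \in S -> (P (A i) + (p i)%:E <= P (B i))%E /\ (P (A' i) + (p i)%:E <= P (B' i))%E.
  by move=> iS; exact: (row_votes (eta i) (kj i) (@measurable_U i) (law_U iS) (@lx i j) s2 t01 tr').
(* With q = tau * vote_rate * al the average exponent per row is at most - l q / 2 + 2 l^2, which is
   minimal at l = q / 8 with value - q^2 / 32. *)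
pose l : R := tau * vote_rate * al / 8.
have v0 := @vote_rate_gt0 R; have v1 := @vote_rate_le1 R.
have tv : 0 < tau * vote_rate <= 1.
  case/andP: t01 => t0 t1; rewrite mulr_gt0//= -[leRHS]mulr1 ler_pM//; exact: ltW.
have tva : 0 < tau * vote_rate * al <= 1.
  case/andP: tv => h1 h2; case/andP: al01 => a0 a1.
  rewrite mulr_gt0//= -[leRHS]mulr1 ler_pM//; exact: ltW.
have l01 : 0 <= l <= 1 / 2 by rewrite /l; apply/andP; split; lra.
have rate : \sum_(i <- enum S) (- l * p i + 2 * l ^+ 2) <=
    - ((tau * vote_rate * al) ^+ 2 * #|S|%:R / 32).
  rewrite big_enum/= big_split/= -mulr_sumr sumr_const.
  have -> : \sum_(i in S) p i = tau * vote_rate * #|[set i in S | `|eta i| <= 1]%SET|%:R.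
    rewrite /p -big_mkcondr/= mulr_natr -sumr_const; apply: eq_bigl => i.
    by rewrite inE.
  rewrite -[X in _ + X]mulr_natl.
  have : l * (tau * vote_rate * (al * #|S|%:R / 2)) <=
         l * (tau * vote_rate * #|[set i in S | `|eta i| <= 1]%SET|%:R).
    by rewrite ler_wpM2l ?(proj1 (andP l01))// ler_wpM2l// ltW// (proj1 (andP tv)).
  rewrite /l; move: (#|[set i in S | _]%SET|%:R) => g; move: (#|S|%:R) => m; lra.
pose E1 := [set x | \sum_(i <- enum S) \1_(B i) x <= \sum_(i <- enum S) \1_(A i) x :> R].
pose E2 := [set x | \sum_(i <- enum S) \1_(B' i) x <= \sum_(i <- enum S) \1_(A' i) x :> R].
pose med x := cw_median S (fun i => \sum_(l < d) Z (kx i l) x * b l + eta i)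
         (fun i l => Z (kx i l) x) (fun i => Z (kw i) x) sg j.
have medE x : med x = median [seq value i x | i <- enum S & 1 / 2 <= `|Z (kx i j) x|].
  rewrite /med /cw_median; congr (median (map _ _)).
  by apply: eq_in_filter => i; rewrite mem_enum => iS; rewrite norm_sg.
(* A median above b j + r loses the vote E1, one below b j - r the vote E2; this is the factor 2 in
   the bound. *)
have sub : [set x | r < `|med x - b j|] `<=` E1 `|` E2.
  move=> x /=; rewrite medE ltr_normr => /orP[h|h]; [left|right].
    have := @lt_median_vote R _ (enum S) (fun i => 1 / 2 <= `|Z (kx i j) x|) (value^~ x) (b j + r).
    rewrite -ltrBrDl => /(_ h); congr (_ <= _); apply: eq_big_seq => i; rewrite mem_enum => iS;
      rewrite indic_bool; case: (boolP (1 / 2 <= _)) => //= Zx; rewrite valueE//.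
      by rewrite lerD2l.
    by rewrite ltrD2l.
  have := @median_lt_vote R _ (enum S) (fun i => 1 / 2 <= `|Z (kx i j) x|) (value^~ x) (b j - r).
  have h' : median [seq value i x | i <- enum S & 1 / 2 <= `|Z (kx i j) x|] < b j - r by lra.
  move=> /(_ h'); congr (_ <= _); apply: eq_big_seq => i; rewrite mem_enum => iS;
    rewrite indic_bool; case: (boolP (1 / 2 <= _)) => //= Zx; rewrite valueE// invrN mulrN.
    by rewrite lerD2l lerNl.
  by rewrite ltrD2l ltrNr.
have mnum i : measurable_fun setT (num i : cs (idx i) -> R).
  apply: measurable_funD => //; apply: measurable_coarse_sub (@measurable_U i).
  apply/fintype.subsetP => k; rewrite !inE => /orP[->//|/imsetP[l' _ ->]].
  by rewrite imset_f ?orbT.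
have mZj i : measurable_fun setT (Z (kx i j) : cs (idx i) -> R).
  by apply: measurable_coord; rewrite !inE imset_f ?orbT.
have mZNj i : measurable_fun setT ((fun x => - Z (kx i j) x) : cs (idx i) -> R) by exact: measurable_funN.
have mAB i := measurable_vote_sets r (mnum i) (mZj i).
have mAB' i : measurable (A' i : set (cs (idx i))) /\ measurable (B' i : set (cs (idx i))).
  have [] := measurable_vote_sets r (mnum i) (mZNj i).
  by rewrite /A' /B'; under eq_set do rewrite normrN; under [X in _ -> measurable X -> _]eq_set do rewrite normrN.
have msum (C : 'I_n -> set T) : (forall i, measurable (C i)) ->
    measurable_fun setT (fun x => \sum_(i <- enum S) \1_(C i) x : R).
  by move=> mC; apply: measurable_sum_seq => i _; exact: measurable_indic.
have toT i (C : set T) : measurable (C : set (cs (idx i))) -> measurable C.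
  exact: coarse_measurable.
have mE1 : measurable E1.
  by apply: measurable_le_set; apply: msum => i; apply: (toT i); case: (mAB i).
have mE2 : measurable E2.
  by apply: measurable_le_set; apply: msum => i; apply: (toT i); case: (mAB' i).
have mmed : measurable_fun setT med.
  rewrite (_ : med = fun x => median [seq value i x | i <- enum S & 1 / 2 <= `|Z (kx i j) x|]); last exact/funext.
  apply: measurable_median => i _.
    by apply: measurable_le_set => //; apply: measurableT_comp.
  apply: measurable_funM; last first.
    by apply: (measurableT_comp measurable_inv); apply: measurable_funM.
  apply: measurable_funD => //; apply: measurable_funM => //; apply: measurable_funD => //.
  by apply: measurable_sum => l'; apply: measurable_funM.
have dis i i' : i != i' -> forall k, k \in idx i -> k \notin idx i'.
  exact: (row_disjoint kx_inj kw_inj kxw).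
have v1' : (P E1 <= (expR (- ((tau * vote_rate * al) ^+ 2 * #|S|%:R / 32)))%:E)%E.
  apply: (@le_trans _ _ (expR (\sum_(i <- enum S) (- l * p i + 2 * l ^+ 2)))%:E); last by rewrite lee_fin ler_expR.
  apply: (vote mZ indepZ (G := idx) (enum_uniq _)) => //.
  - by move=> i i' _ _; exact: dis.
  - by move=> i _; case: (mAB i).
  - by move=> i _; case: (mAB i).
  - by move=> i _ x; rewrite /A /B/= => /andP[_ h] /andP[_]; rewrite leNgt h.
  - by move=> i; rewrite mem_enum => /votes[].
have v2' : (P E2 <= (expR (- ((tau * vote_rate * al) ^+ 2 * #|S|%:R / 32)))%:E)%E.
  apply: (@le_trans _ _ (expR (\sum_(i <- enum S) (- l * p i + 2 * l ^+ 2)))%:E); last by rewrite lee_fin ler_expR.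
  apply: (vote mZ indepZ (G := idx) (enum_uniq _)) => //.
  - by move=> i i' _ _; exact: dis.
  - by move=> i _; case: (mAB' i).
  - by move=> i _; case: (mAB' i).
  - by move=> i _ x; rewrite /A' /B'/= => /andP[_ h] /andP[_]; rewrite leNgt h.
  - by move=> i; rewrite mem_enum => /votes[].
apply: (@le_trans _ _ (P (E1 `|` E2))).
  apply: le_measure => //; rewrite ?inE; last exact: measurableU.
  by apply: measurable_lt_set => //; apply: measurableT_comp => //; exact: measurable_funB.
apply: (le_trans (measureU2 _ mE1 mE2)).
by rewrite mulr2n mulrDl mul1r EFinD; exact: leeD.
Qed.

End CoordinateMedian.

End Round.

(** * Blocks *)

Section Blocks.
Variables (n t : nat).
Hypothesis t0 : (0 < t)%N.
Local Notation b := (small_block n t).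

Definition block_size (k : nat) : nat := if (k < t.-1)%N then b else n./2.

Lemma small_block_le : (t * b <= n./2)%N.
Proof.
rewrite /small_block; have h : (n %/ (2 * t) * (2 * t) <= n)%N by exact: leq_divM.
have -> : (n./2 = n %/ 2)%N by rewrite divn2.
by rewrite leq_divRL// -mulnA mulnC -mulnA.
Qed.

Lemma in_blockE k p : (k < t)%N ->
  in_block n t k p = (k * b <= p < k * b + block_size k)%N.
Proof.
move=> kt; rewrite /in_block /block_size; case: ifP => h; first by rewrite mulSn addnC.
by have -> : k = t.-1 by lia.
Qed.

(** The small blocks before the last fill at most n./2 positions, and the last one adds n./2. *)
Lemma block_end k : (k < t)%N -> (k * b + block_size k <= n)%N.
Proof.
move=> kt; have h := small_block_le; have h2 := odd_double_half n.
rewrite /block_size; case: ifP => k1.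
  have : (k.+1 * b <= t * b)%N by rewrite leq_mul2r; lia.
  rewrite mulSn; move: (k * b)%N (t * b)%N h => x y; lia.
have : (k * b <= t * b)%N by rewrite leq_mul2r; lia.
move: (k * b)%N (t * b)%N h => x y; lia.
Qed.

Lemma in_block_disjoint k k' p : (k < t)%N -> (k' < t)%N ->
  in_block n t k p -> in_block n t k' p -> k = k'.
Proof.
wlog kk' : k k' / (k <= k')%N.
  by move=> H h1 h2 h3 h4; case: (leqP k k') => h; [exact: H|apply/esym; apply: H => //; exact: ltnW].
move=> kt k't; rewrite !in_blockE// => /andP[h1 h2] /andP[h3 h4].
apply/eqP; rewrite eqn_leq kk' leqNgt; apply/negP => lt_kk'.
have kb : block_size k = b by rewrite /block_size; case: ifP => //; lia.
have : (k.+1 * b <= k' * b)%N by rewrite leq_mul2r lt_kk' orbT.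
by rewrite mulSn; move: h2 h3; rewrite kb; move: (k * b)%N (k' * b)%N => x y; lia.
Qed.

Lemma count_interval a m : (a + m <= n)%N ->
  #|[set p : 'I_n | (a <= p < a + m)%N]%SET| = m.
Proof.
move=> amn; rewrite cardsE cardE size_filter -(count_map val (fun p => (a <= p < a + m)%N)).
rewrite -enumT val_enum_ord -(subnKC amn) -addnA iotaD iotaD !count_cat add0n.
rewrite (@eq_in_count _ _ pred0) ?count_pred0; last first.
  by move=> p; rewrite mem_iota /=; lia.
rewrite (@eq_in_count _ _ predT (iota a m)) ?count_predT ?size_iota; last first.
  by move=> p; rewrite mem_iota /=; lia.
rewrite (@eq_in_count _ _ pred0) ?count_pred0; first by lia.
by move=> p; rewrite mem_iota /=; lia.
Qed.

Definition positions (k : nat) : seq 'I_n := enum [set p : 'I_n | in_block n t k p]%SET.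

Lemma size_positions k : (k < t)%N -> size (positions k) = block_size k.
Proof.
move=> kt; rewrite /positions -cardE -[RHS](count_interval (block_end kt)).
by apply: eq_card => p; rewrite !inE in_blockE.
Qed.

Lemma card_block (s : {perm 'I_n}) k : (k < t)%N -> #|block_set s t k| = block_size k.
Proof.
move=> kt; rewrite /block_set card_imset; last exact: perm_inj.
by rewrite -size_positions// /positions -cardE; apply: eq_card => p; rewrite !inE.
Qed.

Lemma block_disjoint (s : {perm 'I_n}) k k' i : (k < t)%N -> (k' < t)%N ->
  i \in block_set s t k -> i \in block_set s t k' -> k = k'.
Proof.
move=> kt k't /imsetP[p pk ->] /imsetP[p' pk' /perm_inj pp'].
move: pk pk'; rewrite !inE -pp'; exact: in_block_disjoint.
Qed.

(** The form in which [sampling] counts: fixed positions, each tested after the permutation. *)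
Lemma card_block_good (s : {perm 'I_n}) k (G : {set 'I_n}) :
  #|[set i in block_set s t k | i \in G]%SET| = count (fun q => s q \in G) (positions k).
Proof.
rewrite /positions -sum1_count big_enum_cond /= sum1dep_card.
rewrite -[RHS](card_imset _ (@perm_inj _ s)); apply: eq_card => i.
rewrite [LHS]inE; apply/andP/imsetP => [[/imsetP[p pk ->] sG]|[p]].
  by exists p => //; rewrite inE sG andbT inE; move: pk; rewrite inE.
rewrite !inE => /andP[pk sG] ->; split=> //; apply/imsetP; exists p => //.
by rewrite inE.
Qed.

End Blocks.

Section MeasurableBoot.
Context {R : realType}.

(** Measurability is asked on S alone, since rows of other blocks need not be measurable for the
    sub-sigma-algebra at hand. *)
Lemma measurable_cw_median d' (T' : measurableType d') n d (S : {set 'I_n})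
    (y : 'I_n -> T' -> R) (X : 'I_n -> 'I_d -> T' -> R) (w sg : 'I_n -> T' -> R) j :
  (forall i, i \in S -> measurable_fun setT (y i)) ->
  (forall i, i \in S -> measurable_fun setT (X i j)) ->
  (forall i, i \in S -> measurable_fun setT (w i)) ->
  (forall i, i \in S -> measurable_fun setT (sg i)) ->
  measurable_fun setT (fun x => cw_median S (y^~ x) (fun i l => X i l x) (w^~ x) (sg^~ x) j).
Proof.
move=> my mX mw msg; apply: measurable_median => i; rewrite mem_enum => iS.
  apply: measurable_le_set => //; apply: measurableT_comp => //.
  by apply: measurable_funM; [exact: msg|exact: mX].
apply: measurable_funM.
  by apply: measurable_funD; [apply: measurable_funM; [exact: msg|exact: my]|exact: mw].
apply: (measurableT_comp measurable_inv).
by apply: measurable_funM; [exact: msg|exact: mX].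
Qed.

End MeasurableBoot.

(** * The bootstrapped estimate *)

Section Model.
Context {R : realType} {dT : measure_display} {T : measurableType dT}.
Variables (P : probability T R) (n d t : nat).
Variables (X : 'I_n -> 'I_d -> T -> R) (W Sg : nat -> 'I_n -> T -> R).
Variable (Pi : T -> {perm 'I_n}).
Hypothesis t0 : (0 < t)%N.
Hypothesis mX : forall i j, measurable_fun setT (X i j).
Hypothesis mW : forall r i, measurable_fun setT (W r i).
Hypothesis mSg : forall r i, measurable_fun setT (Sg r i).
Hypothesis mPi : forall s, measurable (Pi @^-1` [set s]).
Hypothesis lawX : forall i j, centered_normal P 1 (X i j).
Hypothesis lawW : forall r i, centered_normal P 1 (W r i).
Hypothesis indep : mutually_independent P Pi (rand_family (t := t) X W Sg).

Definition sources : finType := option (rand_index n d t).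

(* The permutation is encoded as a real number, so that all the randomness
   forms one independent real-valued family. *)
Definition source (k : sources) : T -> R :=
  match k with
  | None => fun om => (enum_rank (Pi om))%:R
  | Some k => rand_family X W Sg k
  end.

Definition kx (i : 'I_n) (j : 'I_d) : sources := Some (inl (inl (i, j))).
Definition kw (r : 'I_t) (i : 'I_n) : sources := Some (inl (inr (r, i))).
Definition ks (r : 'I_t) (i : 'I_n) : sources := Some (inr (r, i)).

Let preim_Pi (A : set {perm 'I_n}) : measurable (Pi @^-1` A).
Proof.
rewrite (_ : Pi @^-1` A = [set x | exists2 s, `[< A s >] & (Pi @^-1` [set s]) x]).
  by apply: measurable_exists2 => s' _; exact: mPi.
apply/seteqP; split=> x /=; first by move=> h; exists (Pi x) => //; apply/asboolP.
by move=> [s /asboolP As ->].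
Qed.

Let code_preim (B : set R) :
  source None @^-1` B = Pi @^-1` [set s | B (enum_rank s)%:R].
Proof. by []. Qed.

Lemma measurable_source k : measurable_fun setT (source k).
Proof.
case: k => [[[[i j]|[r i]]|[r i]]|] /=; [exact: mX|exact: mW|exact: mSg|].
by move=> _ B mB; rewrite setTI; exact: (@preim_Pi [set s | B (enum_rank s)%:R]).
Qed.

Lemma indep_source B : (forall k, measurable (B k)) ->
  (P (\bigcap_k (source k @^-1` B k)) = \prod_k P (source k @^-1` B k))%E.
Proof.
move=> mB.
rewrite (bigD1 None)//= code_preim.
rewrite (_ : \bigcap_k _ = Pi @^-1` [set s | B None (enum_rank s)%:R] `&`
    \bigcap_k (rand_family X W Sg k @^-1` B (Some k))).
  rewrite indep//; congr (_ * _)%E.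
  rewrite [RHS](reindex_omap Some id)/=; last by case.
  by apply: eq_bigl => k; rewrite eqxx.
apply/seteqP; split=> x.
  by move=> h; split; [exact: (h None I)|move=> k _; exact: (h (Some k) I)].
by move=> [h1 h2] [k|] _; [exact: h2|].
Qed.

Local Notation cs := (coarse source).

Variables (beta : 'I_d -> R) (eta : 'I_n -> R).

Definition response (om : T) (i : 'I_n) : R := \sum_(j < d) X i j om * beta j + eta i.

Definition estimate (s : {perm 'I_n}) (k : nat) (om : T) : 'I_d -> R :=
  boot_acc s t (response om) (fun i j => X i j om) (fun r i => W r i om) (fun r i => Sg r i om) k.

Definition residual (s : {perm 'I_n}) (k : nat) (om : T) (j : 'I_d) : R :=
  beta j - estimate s k om j.

(** Subtracting the fit turns the round into the same regression problem with the residual as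
    unknown signal and unchanged eta. *)
Lemma residual_response s k om i :
  response om i - \sum_(l < d) X i l om * estimate s k om l =
  \sum_(l < d) X i l om * residual s k om l + eta i.
Proof.
rewrite /response addrAC -sumrB; congr (_ + _); apply: eq_bigr => l _.
by rewrite /residual mulrBr.
Qed.

Lemma estimateS s k om j :
  estimate s k.+1 om j = estimate s k om j +
    cw_median (block_set s t k) (fun i => \sum_(l < d) X i l om * residual s k om l + eta i)
      (fun i l => X i l om) (fun i => W k i om) (fun i => Sg k i om) j.
Proof.
rewrite /estimate /=; congr (_ + cw_median _ _ _ _ _ _).
by apply/funext => i; exact: residual_response.
Qed.

Lemma residualS s k om j :
  residual s k.+1 om j = residual s k om j -
    cw_median (block_set s t k) (fun i => \sum_(l < d) X i l om * residual s k om l + eta i)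
      (fun i l => X i l om) (fun i => W k i om) (fun i => Sg k i om) j.
Proof. by rewrite {1}/residual estimateS opprD addrA. Qed.

(* All signs belong to the past: given them, the sign symmetry of X_ij alone
   makes the error of a ratio symmetric. *)
Definition past (s : {perm 'I_n}) (k : nat) : {set sources} :=
  [set c : sources | match c with
     | Some (inl (inl (i, _))) => [exists r : 'I_t, (r < k)%N && (i \in block_set s t r)]
     | Some (inl (inr (r, _))) => (r < k)%N
     | Some (inr _) => true
     | None => false
     end]%SET.

Definition fresh (s : {perm 'I_n}) (k : nat) : {set sources} :=
  [set c : sources | match c with
     | Some (inl (inl (i, _))) => i \in block_set s t k
     | Some (inl (inr (r, _))) => (r : nat) == k
     | _ => false
     end]%SET.

Lemma past_fresh s k : (k < t)%N -> forall c, c \in past s k -> c \notin fresh s k.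
Proof.
move=> kt [[[[i j]|[r i]]|[r i]]|]; rewrite !inE//.
  move=> /existsP[r /andP[rk ir]]; apply/negP => ik.
  by have := block_disjoint t0 (ltn_ord r) kt ir ik; lia.
by lia.
Qed.

Lemma past_sub s k k' : (k <= k')%N -> past s k \subset past s k'.
Proof.
move=> kk'; apply/fintype.subsetP => -[[[[i j]|[r i]]|[r i]]|]; rewrite !inE//; last by lia.
by move=> /existsP[r /andP[rk ir]]; apply/existsP; exists r; rewrite ir andbT; lia.
Qed.

Lemma past_neq_None s k c : c \in past s k -> c \in [set~ None]%SET.
Proof. by case: c => [c|]; rewrite !inE. Qed.

Lemma measurable_estimate s k j : (k <= t)%N ->
  measurable_fun setT ((fun om => estimate s k om j) : cs (past s k) -> R).
Proof.
elim: k j => [|k IH] j kt; first exact: measurable_cst.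
have mE l : measurable_fun setT ((fun om => estimate s k om l) : cs (past s k.+1) -> R).
  by apply: (measurable_coarse_sub (past_sub s (leqnSn k))); apply: IH; exact: ltnW.
under eq_fun do rewrite estimateS.
apply: measurable_funD; first exact: mE.
have mXp i l : i \in block_set s t k -> measurable_fun setT (X i l : cs (past s k.+1) -> R).
  move=> ik; apply: (@measurable_coord _ _ _ _ source _ (kx i l)); rewrite inE.
  by apply/existsP; exists (Ordinal kt); rewrite /= ltnSn.
apply: measurable_cw_median => i ik.
- apply: measurable_funD => //; apply: measurable_sum => l.
  by apply: measurable_funM; [exact: mXp|apply: measurable_funB].
- exact: mXp.
- by apply: (@measurable_coord _ _ _ _ source _ (kw (Ordinal kt) i)); rewrite inE/=.
- by apply: (@measurable_coord _ _ _ _ source _ (ks (Ordinal kt) i)); rewrite inE/=.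
Qed.

Definition sqnorm (v : 'I_d -> R) : R := \sum_(j < d) v j ^+ 2.

(* The sign condition only excludes a null event. *)
Definition miss (s : {perm 'I_n}) (k : nat) (tau : R) (j : 'I_d) : set T :=
  [set om | (forall i, i \in block_set s t k -> Sg k i om ^+ 2 = 1) /\
     tau * Num.sqrt (1 + sqnorm (residual s k om)) < `|residual s k.+1 om j|].

Lemma measurable_set_all d' (T' : measurableType d') (A : {set 'I_n}) (f : 'I_n -> T' -> R) :
  (forall i, i \in A -> measurable_fun setT (f i)) ->
  measurable [set om | forall i, i \in A -> f i om ^+ 2 = 1].
Proof.
move=> mf.
rewrite (_ : mkset _ = \bigcap_(i in [set` A]) (f i @^-1` [set x | x ^+ 2 = 1])).
  apply: fin_bigcap_measurable; first exact: finite_finset.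
  move=> i /= iA; rewrite -[X in measurable X]setTI; apply: mf => //.
  have m2 : measurable_fun setT (fun x : R => x ^+ 2) by exact: measurable_funX.
  by have := m2 measurableT [set 1] (measurable_set1 1); rewrite setTI.
by apply/seteqP; split=> om /= h i iA; exact: h.
Qed.

Lemma measurable_miss s k tau j (I : {set sources}) : (k < t)%N -> past s k.+1 \subset I ->
  measurable (miss s k tau j : set (cs I)).
Proof.
move=> kt sub; apply: measurableI.
  apply: measurable_set_all => i iS; apply: (measurable_coarse_sub sub).
  by apply: (@measurable_coord _ _ _ _ source _ (ks (Ordinal kt) i)); rewrite inE/=.
have mres k' l : (k' <= k.+1)%N -> measurable_fun setT ((fun om => residual s k' om l) : cs I -> R).
  move=> kk'; apply: measurable_funB => //.
  apply: (measurable_coarse_sub (fintype.subset_trans (past_sub s kk') sub)).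
  by apply: measurable_estimate; lia.
apply: measurable_lt_set.
  apply: measurable_funM => //; apply: measurableT_comp; first exact: (continuous_measurable_fun (@sqrt_continuous R)).
  apply: measurable_funD => //; apply: measurable_sum => l.
  by apply: measurable_funX; apply: mres.
by apply: measurableT_comp => //; apply: mres.
Qed.

(** In [med] the residual and the signs are read from the past and the rows and noise from the fresh
    sources. For a frozen past the residual is a constant vector, and [coordinate_median_tail]
    applies. *)
Lemma miss_tail s k (tau al : R) j : (k < t)%N -> 0 < tau <= 1 -> 0 < al <= 1 ->
  al * #|block_set s t k|%:R / 2 <= #|[set i in block_set s t k | `|eta i| <= 1]%SET|%:R ->
  (P (miss s k tau j) <=
   (2 * expR (- ((tau * vote_rate * al) ^+ 2 * #|block_set s t k|%:R / 32)))%:E)%E.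
Proof.
move=> kt t01 al01 good; set S := block_set s t k.
pose r := Ordinal kt.
pose med (om om' : T) := cw_median S (fun i => \sum_(l < d) X i l om' * residual s k om l + eta i)
      (fun i l => X i l om') (fun i => W k i om') (fun i => Sg k i om) j.
pose E : set (cs (past s k) * cs (fresh s k)) :=
  [set p | (forall i, i \in S -> Sg k i p.1 ^+ 2 = 1) /\
     tau * Num.sqrt (1 + sqnorm (residual s k p.1)) < `|med p.1 p.2 - residual s k p.1 j|].
have mSp i : measurable_fun setT (fun p : cs (past s k) * cs (fresh s k) => Sg k i p.1).
  apply: (@measurableT_comp _ _ _ _ _ _ (Sg k i : cs (past s k) -> R)) => //.
  by apply: (@measurable_coord _ _ _ _ source _ (ks r i)); rewrite inE/=.
have mres l : measurable_fun setT (fun p : cs (past s k) * cs (fresh s k) => residual s k p.1 l).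
  apply: measurable_funB => //.
  apply: (@measurableT_comp _ _ _ _ _ _ ((fun om => estimate s k om l) : cs (past s k) -> R)) => //.
  by apply: measurable_estimate; exact: ltnW.
have mXf i l : i \in S -> measurable_fun setT (fun p : cs (past s k) * cs (fresh s k) => X i l p.2).
  move=> iS; apply: (@measurableT_comp _ _ _ _ _ _ (X i l : cs (fresh s k) -> R)) => //.
  by apply: (@measurable_coord _ _ _ _ source _ (kx i l)); rewrite inE.
have mWf i : measurable_fun setT (fun p : cs (past s k) * cs (fresh s k) => W k i p.2).
  apply: (@measurableT_comp _ _ _ _ _ _ (W k i : cs (fresh s k) -> R)) => //.
  by apply: (@measurable_coord _ _ _ _ source _ (kw r i)); rewrite inE/=.
have mE : measurable E.
  apply: measurableI; first by apply: measurable_set_all => i _; exact: mSp.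
  apply: measurable_lt_set.
    apply: measurable_funM => //; apply: measurableT_comp; first exact: (continuous_measurable_fun (@sqrt_continuous R)).
    by apply: measurable_funD => //; apply: measurable_sum => l; apply: measurable_funX.
  apply: measurableT_comp => //; apply: measurable_funB => //.
  apply: measurable_cw_median => i iS //; last exact: mXf.
  apply: measurable_funD => //; apply: measurable_sum => l.
  by apply: measurable_funM => //; exact: mXf.
have -> : miss s k tau j = [set om : T | E (om, om)].
  by apply/seteqP; split=> om; rewrite /miss /E/= residualS -normrN opprB.
apply: (decoupling_le measurable_source indep_source (past_fresh (s := s) kt) mE) => om.
have [hs|hs] := pselect (forall i, i \in S -> Sg k i om ^+ 2 = 1); last first.
  rewrite (_ : mkset _ = set0).
    by rewrite measure0 lee_fin mulr_ge0// expR_ge0.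
  by apply/seteqP; split=> om' // [].
rewrite (_ : mkset _ = [set om' | tau * Num.sqrt (1 + sqnorm (residual s k om)) < `|med om om' - residual s k om j|]).
  apply: (coordinate_median_tail measurable_source indep_source (kx := kx) (kw := kw r)) => //.
  - by move=> i l i' l' [-> ->].
  - by move=> i i' [->].
  - by move=> i; exact: lawW.
by apply/seteqP; split=> om' //= [].
Qed.

Lemma perm_independent s (A : set T) : measurable (A : set (cs [set~ None]%SET)) ->
  (P (Pi @^-1` [set s] `&` A) = P (Pi @^-1` [set s]) * P A)%E.
Proof.
move=> mA; apply: (coarse_indep measurable_source indep_source (I := [set None]%SET) _ _ mA).
  by move=> k; rewrite !inE => /eqP ->.
have mc := @measurable_coord _ _ _ _ source [set None]%SET None (finset.set11 _).
have := mc measurableT [set (enum_rank s)%:R] (measurable_set1 _); rewrite setTI.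
(* The code of a permutation is injective, so Pi = s is a level set of the source [None]. *)
congr measurable; apply/seteqP; split=> x /=; last by move=> ->.
by move=> /eqP; rewrite eqr_nat => /eqP /val_inj /enum_rank_inj.
Qed.

Hypothesis lawSg : forall r i, P (Sg r i @^-1` [set 1]) = (1 / 2)%:E /\
  P (Sg r i @^-1` [set -1]) = (1 / 2)%:E.
Hypothesis lawPi : forall s, P (Pi @^-1` [set s]) = (n`!%:R)^-1%:E.

Lemma sign_event r i : measurable [set om | Sg r i om ^+ 2 != 1] /\
  P [set om | Sg r i om ^+ 2 != 1] = 0%E.
Proof.
have [h1 h2] := lawSg r i.
have m c : measurable (Sg r i @^-1` [set c]).
  by rewrite -[X in measurable X]setTI; apply: mSg.
have -> : [set om | Sg r i om ^+ 2 != 1] = ~` (Sg r i @^-1` [set 1] `|` Sg r i @^-1` [set -1]).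
  apply/seteqP; split=> om /=; rewrite sqrf_eq1 negb_or.
    by move=> /andP[/eqP ? /eqP ?] [].
  by move=> h; apply/andP; split; apply/eqP => h'; apply: h; [left|right].
have mU : measurable (Sg r i @^-1` [set 1] `|` Sg r i @^-1` [set -1]) by exact: measurableU.
split; first exact: measurableC.
have PU : P (Sg r i @^-1` [set 1] `|` Sg r i @^-1` [set -1]) = 1%E.
  rewrite measureU//.
    by rewrite [X in (X + _)%E]h1 [X in (_ + X)%E]h2 -EFinD -mulrDl divff.
  by apply/seteqP; split=> om //= [-> /eqP]; rewrite -subr_eq0 opprK (_ : 1 + 1 = 2%:R)// pnatr_eq0.
by rewrite probability_setC// PU subee.
Qed.

Definition balanced (al : R) (s : {perm 'I_n}) (k : nat) : bool :=
  al * #|block_set s t k|%:R / 2 <= #|[set i in block_set s t k | `|eta i| <= 1]%SET|%:R.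

Hypothesis n0 : (0 < n)%N.
Hypothesis d0 : (0 < d)%N.
Hypothesis dn : (d <= n)%N.

(** The event is a disjoint union over unbalanced permutations of probability 1 / n! each, and
    [sampling] counts them. *)
Lemma unbalanced_event (al : R) k : (k < t)%N -> 0 <= al ->
  al * n%:R <= #|[set i : 'I_n | `|eta i| <= 1]%SET|%:R ->
  measurable [set om | ~~ balanced al (Pi om) k] /\
  (P [set om | ~~ balanced al (Pi om) k] <= (expR (- (al * (block_size n t k)%:R / 12)))%:E)%E.
Proof.
move=> kt al0 alG.
have -> : [set om | ~~ balanced al (Pi om) k] =
    [set om | exists2 s, ~~ balanced al s k & (Pi @^-1` [set s]) om].
  by apply/seteqP; split=> om /=; [move=> h; exists (Pi om)|move=> [s h ->]].
have mU := measurable_exists2 (fun s (_ : ~~ balanced al s k) => mPi s).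
have PU := union_bound P (fun s (_ : ~~ balanced al s k) => mPi s).
split=> //; apply: (le_trans PU).
rewrite (eq_bigr (fun=> (n`!%:R)^-1%:E)); last by move=> s _; exact: lawPi.
rewrite sumEFin lee_fin.
have := @sampling R n n0 _ (positions n t k) al (enum_uniq _) al0 alG.
rewrite (size_positions n t0 kt) natr_sum => h.
rewrite -(@ler_pM2l _ n`!%:R) ?ltr0n ?fact_gt0//; apply: le_trans h.
rewrite mulr_sumr (eq_bigr (fun=> 1)); last by move=> s _; rewrite mulfV// pnatr_eq0 -lt0n fact_gt0.
rewrite le_eqVlt; apply/orP; left; apply/eqP; apply: eq_bigl => s.
rewrite /balanced -ltNge (card_block t0 _ kt); congr (_%:R < _).
by rewrite -card_block_good; apply: eq_card => i; rewrite !inE.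
Qed.

(** On Pi = s the random blocks are those of s, and [missed s] is independent of Pi. So a balanced s
    contributes at most delta / n!, and the sum over all s is at most delta. The remaining
    exceptional events are unbalanced blocks, the null event of wrong signs, and a large operator
    norm. *)
Lemma good_event (al : R) (tau : nat -> R) :
  0 < al <= 1 -> al * n%:R <= #|[set i : 'I_n | `|eta i| <= 1]%SET|%:R ->
  (forall k, (k < t)%N -> 0 < tau k <= 1) ->
  exists E : set T, [/\ measurable E,
    ((1 - (\sum_(k < t) expR (- (al * (block_size n t k)%:R / 12)) +
        \sum_(k < t) d%:R * (2 * expR (- ((tau k * vote_rate * al) ^+ 2 * (block_size n t k)%:R / 32))) +
        expR (- n%:R)))%:E <= P E)%E,
    (forall om, E om -> forall k, (k < t)%N ->
      sqnorm (residual (Pi om) k.+1 om) <= d%:R * tau k ^+ 2 * (1 + sqnorm (residual (Pi om) k om))) &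
    (forall om, E om -> forall v : 'I_d -> R,
      \sum_(i < n) (\sum_(j < d) X i j om * v j) ^+ 2 <= 8 * 68 * n%:R * sqnorm v)].
Proof.
move=> al01 alG tau01.
have al0 : 0 <= al by apply: ltW; case/andP: al01.
(* The noise of the first round serves as the auxiliary Gaussians of [opnorm_event]. *)
pose r0 : 'I_t := Ordinal t0.
have [Eop [mEop PEop opP]] : exists E : set T, [/\ measurable E,
    (P E <= (expR (- n%:R))%:E)%E &
    forall x, ~ E x -> forall v : 'I_d -> R,
    \sum_(i < n) (\sum_(j < d) X i j x * v j) ^+ 2 <= 8 * 68 * n%:R * sqnorm v].
  apply: (opnorm_event measurable_source indep_source (kx := kx) (kw := kw r0)) => //.
  - by move=> i l i' l' [-> ->].
  - by move=> i i' [->].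
  - by move=> i; exact: lawW.
pose unbal (k : 'I_t) : set T := [set om | ~~ balanced al (Pi om) k].
have unbalP k := unbalanced_event (ltn_ord k) al0 alG.
have mB1 := measurable_exists2 (A := unbal) (Q := xpredT) (fun k _ => (unbalP k).1).
have PB1 := union_bound P (A := unbal) (Q := xpredT) (fun k _ => (unbalP k).1).
pose sgn (q : 'I_t * 'I_n) : set T := [set om | Sg q.1 q.2 om ^+ 2 != 1].
have mB2 := measurable_exists2 (A := sgn) (Q := xpredT) (fun q _ => (sign_event q.1 q.2).1).
have PB2 := union_bound P (A := sgn) (Q := xpredT) (fun q _ => (sign_event q.1 q.2).1).
pose missed (s : {perm 'I_n}) : set T :=
  [set om | exists2 q : 'I_t * 'I_d, true & miss s q.1 (tau q.1) q.2 om].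
have subN s (k : 'I_t) : past s k.+1 \subset [set~ None]%SET.
  by apply/fintype.subsetP => c; exact: past_neq_None.
have mmiss s (q : 'I_t * 'I_d) : measurable (miss s q.1 (tau q.1) q.2 : set (cs [set~ None]%SET)).
  exact: measurable_miss (ltn_ord _) (subN _ _).
pose delta := \sum_(k < t) d%:R * (2 * expR (- ((tau k * vote_rate * al) ^+ 2 * (block_size n t k)%:R / 32))).
have delta0 : 0 <= delta by apply: sumr_ge0 => k _; rewrite !mulr_ge0 ?expR_ge0.
pose allbal s := [forall k : 'I_t, balanced al s k].
have missedP s : allbal s -> measurable (missed s) /\ (P (missed s) <= delta%:E)%E /\
    (P (Pi @^-1` [set s] `&` missed s) <= ((n`!%:R)^-1 * delta)%:E)%E.
  move=> /forallP bal.
  have mmT (q : 'I_t * 'I_d) : measurable (miss s q.1 (tau q.1) q.2).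
    exact: (coarse_measurable measurable_source (mmiss s q)).
  have mc : measurable (missed s : set (cs [set~ None]%SET)).
    by apply: measurable_exists2 => q _; exact: mmiss.
  have Pm : (P (missed s) <= delta%:E)%E.
    apply: (le_trans (union_bound P (fun q _ => mmT q))).
    pose f (k : 'I_t) : R := 2 * expR (- ((tau k * vote_rate * al) ^+ 2 * (block_size n t k)%:R / 32)).
    apply: (@le_trans _ _ (\sum_(q : 'I_t * 'I_d) (f q.1)%:E)%E).
      apply: lee_sum => q _; rewrite /f -(card_block t0 s (ltn_ord q.1)).
      by apply: miss_tail => //; [exact: tau01|exact: bal].
    rewrite sumEFin lee_fin le_eqVlt; apply/orP; left; apply/eqP.
    rewrite -(pair_bigA _ (fun (k : 'I_t) (_ : 'I_d) => f k))/=; apply: eq_bigr => k _.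
    by rewrite sumr_const card_ord mulr_natl.
  split; first exact: (coarse_measurable measurable_source mc).
  split=> //; rewrite perm_independent// lawPi EFinM.
  by apply: lee_pmul => //; rewrite lee_fin.
pose hit (s : {perm 'I_n}) : set T := Pi @^-1` [set s] `&` missed s.
have mhit s : allbal s -> measurable (hit s).
  by move=> /missedP[ms _]; exact: measurableI.
have mB3 := measurable_exists2 mhit.
have PB3 := union_bound P mhit.
set B1 := (X in measurable X) in mB1; set B2 := (X in measurable X) in mB2.
set B3 := (X in measurable X) in mB3.
have P1 : (P B1 <= (\sum_(k < t) expR (- (al * (block_size n t k)%:R / 12)))%:E)%E.
  by apply: (le_trans PB1); rewrite -sumEFin; apply: lee_sum => k _; exact: (unbalP k).2.
have P2 : P B2 = 0%E.
  apply/eqP; rewrite eq_le measure_ge0 andbT; apply: (le_trans PB2).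
  by rewrite big1// => q _; exact: (sign_event q.1 q.2).2.
have P3 : (P B3 <= delta%:E)%E.
  apply: (le_trans PB3).
  apply: (@le_trans _ _ (\sum_(s | allbal s) ((n`!%:R)^-1 * delta)%:E)%E).
    by apply: lee_sum => s /missedP[_ []].
  rewrite sumEFin lee_fin.
  apply: (@le_trans _ _ (\sum_(s : {perm 'I_n}) (n`!%:R)^-1 * delta)).
    by rewrite big_mkcond/=; apply: ler_sum => s _; case: ifP => // _; rewrite mulr_ge0.
  rewrite sumr_const -[#|_|]/(#|{: {perm 'I_n}}|) (_ : #|{: {perm 'I_n}}| = n`!).
    by rewrite -[leLHS]mulr_natl mulrA mulfV ?mul1r// pnatr_eq0 -lt0n fact_gt0.
  by rewrite -(card_Sn n); apply: eq_card.
have mB : measurable (B1 `|` B3 `|` Eop `|` B2) by do 3 (apply: measurableU => //).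
exists (~` (B1 `|` B3 `|` Eop `|` B2)); split.
- exact: measurableC.
- rewrite probability_setC// EFinB leeB//.
  have PU A B : measurable A -> measurable B -> (P (A `|` B) <= P A + P B)%E.
    by move=> mA mB'; exact: measureU2.
  apply: (le_trans (PU _ _ _ mB2)); first by do 2 (apply: measurableU => //).
  rewrite P2 adde0 EFinD.
  apply: (le_trans (PU _ _ _ mEop)); first exact: measurableU.
  apply: leeD => //; rewrite EFinD; apply: (le_trans (PU _ _ mB1 mB3)).
  exact: leeD.
- move=> om /= nB k kt.
  have bal : allbal (Pi om).
    apply/forallP => k'; apply/negPn/negP => h; apply: nB; left; left; left.
    by exists k'.
  have sg1 i : Sg k i om ^+ 2 = 1.
    apply/eqP/negPn/negP => h; apply: nB; right; exists (Ordinal kt, i) => //.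
  have nomiss j : `|residual (Pi om) k.+1 om j| <= tau k * Num.sqrt (1 + sqnorm (residual (Pi om) k om)).
    rewrite leNgt; apply/negP => h; apply: nB; left; left; right.
    exists (Pi om) => //; split=> //; exists (Ordinal kt, j) => //.
  have q0 : 0 <= 1 + sqnorm (residual (Pi om) k om).
    by rewrite addr_ge0// sumr_ge0// => j _; exact: sqr_ge0.
  rewrite -mulrA -[d in leRHS]card_ord mulr_natl -sumr_const; apply: ler_sum => j _.
  rewrite -real_normK ?num_real// -[X in _ * X]sqr_sqrtr// -exprMn lerXn2r// ?nnegrE//.
  by rewrite mulr_ge0 ?sqrtr_ge0// ltW//; case/andP: (tau01 k kt).
- move=> om /= nB; apply: opP => h; apply: nB; left; right.
  exact: h.
Qed.

End Model.

(** * Numerical estimates *)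

Section Numerics.
Context {R : realType}.

(** From e^(-1/6) >= 5/6 and (5/6)^6 > 1/3. *)
Lemma expR1_le3 : expR 1 <= 3 :> R.
Proof.
pose y : R := expR (- (1 / 6)).
have y1 : 5 / 6 <= y by have := expR_ge1Dx (- (1 / 6) : R); rewrite -/y; lra.
have y3 : 289 / 500 <= y * y * y.
  have h2 : 25 / 36 <= y * y by nra.
  by nra.
have E : expR 1 * ((y * y * y) * (y * y * y)) = 1 :> R.
  by rewrite /y -!expRD -[RHS]expR0; congr expR; field.
have := expR_gt0 (1 : R); move: (y * y * y) y3 E => z z3 E e0.
have z2 : 1 / 3 <= z * z by nra.
have : expR 1 * (1 / 3) <= expR 1 * (z * z) :> R by rewrite ler_pM2l.
rewrite E; lra.
Qed.

Lemma nrounds_bounds (Delta : R) : 1 <= ln Delta ->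
  ln Delta <= (nrounds Delta)%:R <= 2 * ln Delta.
Proof.
move=> L1; have /andP[h1 h2] := ceil_itv (ln Delta).
have c0 : 0 <= Num.ceil (ln Delta) by rewrite ceil_ge0; lra.
have -> : (nrounds Delta)%:R = (Num.ceil (ln Delta))%:~R :> R.
  by rewrite /nrounds natr_absz ger0_norm.
rewrite h2 /=; move: h1; rewrite intrB; lra.
Qed.

(** The quotient q is at least 1, so n < (q + 1) m <= 2 q m. *)
Lemma half_le_floor (n m : nat) : (0 < m)%N -> (m <= n)%N ->
  n%:R / (2 * m%:R) <= (n %/ m)%:R :> R.
Proof.
move=> m0 mn; rewrite ler_pdivrMr ?mulr_gt0 ?ltr0n// -!natrM ler_nat.
have h := divn_eq n m; have h2 := ltn_pmod n m0.
have h3 : (1 <= n %/ m)%N by rewrite divn_gt0.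
move: h h2 h3; move: (n %/ m)%N (n %% m)%N => q r; nia.
Qed.

(* A linear contraction by e^-2 forgets the initial error after ln Delta steps. *)
Lemma affine_contraction (B : nat -> R) (Delta : R) (t : nat) : 0 < Delta ->
  ln Delta <= t.+1%:R -> B 0%N <= Delta ^+ 2 ->
  (forall k, (k < t)%N -> B k.+1 <= expR (- 2) * (1 + B k)) ->
  B t <= 10.
Proof.
move=> D0 Dt B0 BS.
have e2 : expR (- 2) <= 1 / 3 :> R.
  have h := expR_ge1Dx (2 : R); have E : expR (- 2) * expR 2 = 1 :> R by rewrite -expRD addNr expR0.
  have := expR_gt0 (- 2 : R); nra.
have e0 : 0 < expR (- 2) :> R by exact: expR_gt0.
(* The summand 1 reproduces itself, because e^-2 (1 + 1) <= 1. *)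
have H k : (k <= t)%N -> B k <= expR (- 2) ^+ k * Delta ^+ 2 + 1.
  elim: k => [|k IH] kt; first by rewrite expr0 mul1r; lra.
  apply: (le_trans (BS k kt)); rewrite exprS -mulrA.
  have := IH (ltnW kt); move: (_ ^+ k * _) => y h.
  have : expR (- 2) * (1 + B k) <= expR (- 2) * (1 + (y + 1)) by rewrite ler_pM2l// lerD2l.
  lra.
apply: (le_trans (H t (leqnn t))).
(* The final round lies outside these t steps, so only ln Delta <= t + 1 is at hand: a factor e^2 <=
   9 remains, and 9 + 1 = 10. *)
have Dle : Delta ^+ 2 <= expR 1 ^+ 2 * expR 2 ^+ t.
  have DE : expR (ln Delta) = Delta by rewrite lnK.
  rewrite -{1}DE -!expRM_natl -expRD ler_expR.
  move: Dt; rewrite -natr1; lra.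
have E : expR (- 2) ^+ t * expR 2 ^+ t = 1 :> R.
  by rewrite -exprMn -expRD addNr expR0 expr1n.
have : expR (- 2) ^+ t * Delta ^+ 2 <= expR (- 2) ^+ t * (expR 1 ^+ 2 * expR 2 ^+ t).
  by rewrite ler_pM2l// exprn_gt0.
have -> : expR (- 2) ^+ t * (expR 1 ^+ 2 * expR 2 ^+ t) = expR 1 ^+ 2 :> R by rewrite mulrCA E mulr1.
have := @expR1_le3; have := expR_gt0 (1 : R); move: (expR 1) (expR (-2) ^+ t * _) => e z; nra.
Qed.

Section Failure.
Variables (d : nat) (eps L : R).
Hypotheses (d0 : (0 < d)%N) (eps01 : 0 < eps <= 1 / 2) (L1 : 1 <= L).
Local Notation l1 := (ln (d%:R / eps)).
Local Notation Lam := (l1 + ln L).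

Let dR : 1 <= d%:R :> R. Proof. by rewrite ler1n. Qed.

Let eps0 : 0 < eps. Proof. by case/andP: eps01. Qed.

Lemma expR_ln_ratio : expR (- l1) = eps / d%:R.
Proof.
by rewrite expRN lnK ?invf_div// posrE divr_gt0//; have := dR; lra.
Qed.

Lemma expR_ln_ratio_le : expR (- l1) <= 1 / 2.
Proof.
rewrite expR_ln_ratio ler_pdivrMr; last by have := dR; lra.
by case/andP: eps01 => _ e; have := dR; lra.
Qed.

Lemma ln_ratio_ge : 1 / 2 <= l1.
Proof.
have := expR_ge1Dx (- l1); have := expR_ln_ratio_le.
by move: (ln _) (expR _) => z e; lra.
Qed.

Lemma lnL_ge0 : 0 <= ln L. Proof. exact: ln_ge0. Qed.

Lemma expR_Lam : expR (- Lam) = eps / d%:R / L.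
Proof. by rewrite opprD expRD expR_ln_ratio expRN lnK// posrE; exact: lt_le_trans ltr01 L1. Qed.

(** Of the m + 1 factors expR (- Lam), one is kept as eps / (d L) and the others are at most 1/2. *)
Lemma expR_Lam_le (m : nat) (x : R) : m.+1%:R * Lam <= x ->
  expR (- x) <= (1 / 2) ^+ m * (eps / d%:R / L).
Proof.
move=> h; apply: (@le_trans _ _ (expR (m.+1%:R * - Lam))).
  by rewrite ler_expR mulrN lerN2.
have dp := lt_le_trans ltr01 dR; have Lp := lt_le_trans ltr01 L1.
rewrite expRM_natl exprSr expR_Lam ler_pM2r; last by rewrite !divr_gt0.
rewrite -expR_Lam lerXn2r// ?nnegrE ?expR_ge0//.
apply: le_trans expR_ln_ratio_le; rewrite ler_expR lerN2 lerDl; exact: lnL_ge0.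
Qed.

Lemma expR_ratio_le (m : nat) (x : R) : m.+1%:R * l1 <= x ->
  expR (- x) <= (1 / 2) ^+ m * (eps / d%:R).
Proof.
move=> h; apply: (@le_trans _ _ (expR (m.+1%:R * - l1))).
  by rewrite ler_expR mulrN lerN2.
have dp := lt_le_trans ltr01 dR.
rewrite expRM_natl exprSr expR_ln_ratio ler_pM2r; last by rewrite divr_gt0.
by rewrite -expR_ln_ratio lerXn2r// ?nnegrE ?expR_ge0//; exact: expR_ln_ratio_le.
Qed.

(** The factor 1 / (d L) in expR (- Lam) pays for the union over d coordinates and at most 2 L
    rounds. The last round occurs once, so [l1] suffices there. The three shares are eps / 4, 3 eps
    / 8 and eps / 8. *)
Lemma failure_bound (t : nat) (a x : nat -> R) (y : R) : (0 < t)%N -> t%:R <= 2 * L ->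
  (forall k, (k < t)%N -> 4 * Lam <= a k) ->
  (forall k, (k < t.-1)%N -> 5 * Lam <= x k) ->
  5 * l1 <= x t.-1 -> 4 * Lam <= y ->
  \sum_(k < t) expR (- a k) + \sum_(k < t) d%:R * (2 * expR (- x k)) + expR (- y) <= eps.
Proof.
move=> t0 tL ha hx hxt hy.
have Lp := lt_le_trans ltr01 L1; have L1' := L1; have e0 := eps0.
have dp := lt_le_trans ltr01 dR; have d1 := dR.
have w0 : 0 < eps / d%:R / L by rewrite !divr_gt0.
have wd : eps / d%:R / L * (2 * L) <= 2 * eps.
  have -> : eps / d%:R / L * (2 * L) = 2 * eps / d%:R by field; rewrite !gt_eqF.
  by rewrite ler_pdivrMr// ler_peMr//; lra.
have wt : t%:R * (eps / d%:R / L) <= 2 * eps.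
  by apply: le_trans wd; rewrite mulrC ler_pM2l.
have w1 : eps / d%:R / L <= eps.
  have t1 : 1 <= t%:R :> R by rewrite ler1n.
  rewrite ler_pdivrMr// ler_pdivrMr// -mulrA ler_peMr//; nra.
have S1 : \sum_(k < t) expR (- a k) <= eps / 4.
  apply: (@le_trans _ _ (\sum_(k < t) (1 / 2) ^+ 3 * (eps / d%:R / L))).
    by apply: ler_sum => k _; apply: expR_Lam_le; exact: ha.
  rewrite sumr_const card_ord -[leLHS]mulr_natl mulrCA.
  have -> : (1 / 2) ^+ 3 = 1 / 8 :> R by rewrite !exprS expr0; lra.
  lra.
have S2 : \sum_(k < t) d%:R * (2 * expR (- x k)) <= 3 / 8 * eps.
  have h5 : (1 / 2) ^+ 4 = 1 / 16 :> R by rewrite !exprS expr0; lra.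
  rewrite -(prednK t0) big_ord_recr/=.
  have last : d%:R * (2 * expR (- x t.-1)) <= eps / 8.
    have := expR_ratio_le (m := 4) hxt; rewrite h5 => h.
    have : d%:R * expR (- x t.-1) <= d%:R * (1 / 16 * (eps / d%:R)) by rewrite ler_pM2l.
    have -> : d%:R * (1 / 16 * (eps / d%:R)) = eps / 16 by field; rewrite gt_eqF.
    lra.
  have init : \sum_(k < t.-1) d%:R * (2 * expR (- x k)) <= eps / 4.
    apply: (@le_trans _ _ (\sum_(k < t.-1) (eps / L / 8))).
      apply: ler_sum => k _.
      have := expR_Lam_le (m := 4) (hx k (ltn_ord k)); rewrite h5 => h.
      have : d%:R * expR (- x k) <= d%:R * (1 / 16 * (eps / d%:R / L)) by rewrite ler_pM2l.
      have -> : d%:R * (1 / 16 * (eps / d%:R / L)) = eps / L / 16 by field; rewrite !gt_eqF.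
      move: (eps / L) (expR _) => u v; lra.
    rewrite sumr_const card_ord -[leLHS]mulr_natl.
    have : t.-1%:R <= 2 * L by apply: le_trans tL; rewrite ler_nat leq_pred.
    have w : 0 < eps / L by rewrite divr_gt0.
    move=> h; have : t.-1%:R * (eps / L) <= 2 * L * (eps / L) by rewrite ler_pM2r.
    have -> : 2 * L * (eps / L) = 2 * eps by field; rewrite gt_eqF.
    move: (eps / L) => u; lra.
  lra.
have S3 : expR (- y) <= eps / 8.
  apply: (le_trans (expR_Lam_le (m := 3) hy)).
  have -> : (1 / 2) ^+ 3 = 1 / 8 :> R by rewrite !exprS expr0; lra.
  lra.
lra.
Qed.

End Failure.

End Numerics.

(** * Choice of the constants and assembly *)

Theorem mainTheorem4 (R : realType) :
  exists C C' : R, 0 < C /\ 0 < C' /\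
  forall (n d : nat) (beta_star : 'I_d -> R) (eta : 'I_n -> R)
         (alpha Delta eps : R),
    0 < alpha <= 1 ->
    alpha * n%:R <= #|[set i : 'I_n | `|eta i| <= 1]|%:R ->
    3 * (1 + Num.sqrt (\sum_(j < d) beta_star j ^+ 2)) <= Delta ->
    0 < eps <= 1 / 2 ->
    C * (d%:R * ln Delta / alpha ^+ 2) * (ln (d%:R / eps) + ln (ln Delta))
      <= n%:R ->
  forall (dT : measure_display) (T : measurableType dT) (P : probability T R)
         (X : 'I_n -> 'I_d -> T -> R) (W Sg : nat -> 'I_n -> T -> R)
         (Pi : T -> {perm 'I_n}),
    (* measurability of all the random variables *)
    (forall i j, measurable_fun setT (X i j)) ->
    (forall r i, measurable_fun setT (W r i)) ->
    (forall r i, measurable_fun setT (Sg r i)) ->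
    (forall s, measurable (Pi @^-1` [set s])) ->
    (* distributions: X_ij ~ N(0,1), w ~ N(0,1), sigma Rademacher, Pi uniform *)
    (forall i j B, measurable B -> P (X i j @^-1` B) = normal_prob 0 1 B) ->
    (forall r i B, measurable B -> P (W r i @^-1` B) = normal_prob 0 1 B) ->
    (forall r i, P (Sg r i @^-1` [set 1]) = (1 / 2)%:E /\
                 P (Sg r i @^-1` [set -1]) = (1 / 2)%:E) ->
    (forall s, P (Pi @^-1` [set s]) = (n`!%:R)^-1%:E) ->
    (* joint independence of everything used by the algorithm *)
    mutually_independent P Pi (rand_family (t := nrounds Delta) X W Sg) ->
    exists E : set T, measurable E /\
      E `<=` [set om |
        let Xo := fun i j => X i j om in
        let y := fun i => \sum_(j < d) Xo i j * beta_star j + eta i in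
        let bhat := bootstrapped_median Delta (Pi om) y Xo
                      (fun r i => W r i om) (fun r i => Sg r i om) in
        (n%:R)^-1 * \sum_(i < n) (\sum_(j < d) Xo i j * (beta_star j - bhat j)) ^+ 2
          <= C' * (d%:R * ln (d%:R / eps)) / (alpha ^+ 2 * n%:R)] /\
      ((1 - eps)%:E <= P E)%E.

Proof.
set v := @vote_rate R.
have v0 : 0 < v by exact: vote_rate_gt0.
have v1 : v <= 1 by exact: vote_rate_le1.
have v20 : 0 < v ^+ 2 by rewrite exprn_gt0.
have v21 : v ^+ 2 <= 1 by rewrite exprn_ile1// ltW.
(* The numerator is 5 * 32 * 9 * 8: 5 from [failure_bound], 32 from the median tail, 9 >= e^2 from
   [tau1], and 8 because a block has at least n / (8 L) rows. *)
pose C : R := 36 * 40 * 8 / v ^+ 2.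
(* Here 16 * 40 = 5 * 32 * 4, the last block having at least n / 4 rows. *)
pose KK : R := 16 * 40 / v ^+ 2.
have Cv : C * v ^+ 2 = 36 * 40 * 8 by rewrite /C divfK// gt_eqF.
have Kv : KK * v ^+ 2 = 16 * 40 by rewrite /KK divfK// gt_eqF.
have C0 : 0 < C by rewrite /C divr_gt0// !mulr_gt0.
have K0 : 0 < KK by rewrite /KK divr_gt0// !mulr_gt0.
(* 8 * 68 is the operator norm constant, and 11 bounds 1 + |u|^2 before the last round. *)
exists C, (8 * 68 * 11 * KK); split=> //; split; first by apply: mulr_gt0 => //; rewrite !mulr_gt0.
move=> n d beta eta al Delta eps al01 alG hD eps01 hn dT T P X W Sg Pi mX mW mSg mPi lX lW lSg lPi ind.
(* For d = 0 both sides of the bound are 0; from here on ln (d / eps) >= 1/2. *)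
have [dz|d0] := posnP d.
  exists setT; split=> //; split; last first.
    by rewrite probability_setT lee_fin gerBl ltW//; case/andP: eps01.
  move=> om _ /=; have -> : d%:R = 0 :> R by rewrite dz.
  rewrite mul0r mulr0 mul0r big1 ?mulr0// => i _.
  rewrite big1 ?expr0n// => j; suff : (j < 0)%N by [].
  by rewrite -[X in (_ < X)%N]dz.
set L := ln Delta; set l1 := ln (d%:R / eps).
have bn0 : 0 <= Num.sqrt (\sum_(j < d) beta j ^+ 2) by exact: sqrtr_ge0.
have D3 : 3 <= Delta by lra.
have D0 : 0 < Delta by lra.
have L1 : 1 <= L.
  by rewrite /L -ler_expR lnK//; exact: le_trans expR1_le3 D3.
have dR : 1 <= d%:R :> R by rewrite ler1n.
have dp : 0 < d%:R :> R by lra.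
have e0 : 0 < eps by case/andP: eps01.
have a0 : 0 < al by case/andP: al01.
have a1 : al <= 1 by case/andP: al01.
have a20 : 0 < al ^+ 2 by rewrite exprn_gt0.
have a21 : al ^+ 2 <= al by rewrite expr2 ler_piMl// ltW.
have l1h : 1 / 2 <= l1 by exact: ln_ratio_ge d0 eps01.
have l20 : 0 <= ln L by exact: lnL_ge0.
set Lam := l1 + ln L.
rewrite -/L -/l1 -/Lam in hn.
have Lamh : 1 / 2 <= Lam by rewrite /Lam; lra.
have Lam0 : 0 <= Lam by lra.
have hn' : C * (d%:R * L * Lam) <= al ^+ 2 * n%:R.
  rewrite [leRHS]mulrC -ler_pdivrMr//; apply: le_trans hn.
  by rewrite le_eqVlt; apply/orP; left; apply/eqP; field; rewrite gt_eqF.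
have nR0 : 0 <= n%:R :> R by rewrite ler0n.
have C1 : 36 * 40 * 8 <= C by rewrite -Cv ler_piMr// ltW.
have dL : 1 <= d%:R * L by rewrite -[leLHS]mulr1; apply: ler_pM.
have dLL : L * Lam <= d%:R * L * Lam by rewrite -mulrA ler_peMl// mulr_ge0//; lra.
have dLd : d%:R * Lam <= d%:R * L * Lam by rewrite ler_wpM2r// ler_peMr// ltW.
have LLam : Lam <= L * Lam by rewrite ler_peMl//; lra.
have an : al ^+ 2 * n%:R <= n%:R by rewrite ler_piMl//; lra.
(* The sample size with alpha dropped; it yields n >= 1, d <= n and 2 t <= n, the last so that
   rounding a block size down loses at most half. *)
have big x : 0 <= x -> x <= d%:R * L * Lam -> 36 * 40 * 8 * x <= n%:R.
  move=> x0 hx; apply: le_trans an; apply: le_trans hn'; apply: ler_pM => //.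
have n1 : 1 <= n%:R :> R.
  by have := big _ Lam0 (le_trans LLam dLL); lra.
have nRp : 0 < n%:R :> R by exact: lt_le_trans ltr01 n1.
have n0 : (0 < n)%N by rewrite -(ler1n R).
have dn : (d <= n)%N.
  rewrite -(ler_nat R).
  have := big _ (mulr_ge0 (ltW dp) Lam0) dLd.
  have : d%:R * (1 / 2) <= d%:R * Lam by rewrite ler_pM2l.
  lra.
have /andP[tl th] := nrounds_bounds L1.
set t := nrounds Delta in tl th.
rewrite -/L in tl th.
have t1 : 1 <= t%:R :> R by apply: le_trans tl.
have t0 : (0 < t)%N by rewrite -(ler1n R).
have n2t : (2 * t <= n)%N.
  rewrite -(ler_nat R) natrM.
  have h : 0 <= L * Lam by rewrite mulr_ge0//; lra.
  have := big _ h dLL.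
  have : L * (1 / 2) <= L * Lam by rewrite ler_pM2l//; lra.
  lra.
have E4 : 2 * 2 = 4 :> R by rewrite -natrM.
have mlast : n%:R / 4 <= (n./2)%:R :> R.
  have n2 : (2 <= n)%N by apply: leq_trans n2t; rewrite leq_pmulr.
  by have := @half_le_floor R n 2 isT n2; rewrite divn2 E4.
have msmall : n%:R / (4 * t%:R) <= (small_block n t)%:R :> R.
  have t2 : (0 < 2 * t)%N by rewrite muln_gt0.
  by have := @half_le_floor R n _ t2 n2t; rewrite natrM mulrA E4.
have msize k : n%:R / (4 * t%:R) <= (block_size n t k)%:R :> R.
  rewrite /block_size; case: ifP => // _; apply: le_trans mlast.
  by rewrite ler_pM2l// lef_pV2 ?posrE//; lra.
have mL k : n%:R / (8 * L) <= (block_size n t k)%:R :> R.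
  apply: le_trans (msize k); rewrite ler_pM2l//.
  by rewrite lef_pV2 ?posrE//; lra.
have Lp : 0 < L := lt_le_trans ltr01 L1.
have amL k : C * (d%:R * Lam) <= 8 * (al ^+ 2 * (block_size n t k)%:R).
  have h : n%:R <= (block_size n t k)%:R * (8 * L).
    by rewrite -ler_pdivrMr ?mulr_gt0.
  have h2 : al ^+ 2 * n%:R <= al ^+ 2 * ((block_size n t k)%:R * (8 * L)) by rewrite ler_pM2l.
  have h3 := le_trans hn' h2.
  rewrite -(ler_pM2l Lp).
  have -> : L * (C * (d%:R * Lam)) = C * (d%:R * L * Lam) by ring.
  by apply: (le_trans h3); rewrite le_eqVlt; apply/orP; left; apply/eqP; ring.
(* [tau1] makes d tau^2 equal to e^-2. [tau2] is chosen so that the last block attains the exponent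
   5 l1, and d tau2^2 is the final error up to a constant. *)
pose tau1 : R := expR (- 1) / Num.sqrt d%:R.
pose tau2 : R := Num.sqrt (KK * l1 / (al ^+ 2 * n%:R)).
pose tau (k : nat) : R := if (k < t.-1)%N then tau1 else tau2.
have tau1sq : tau1 ^+ 2 = expR (- 2) / d%:R.
  rewrite /tau1 expr_div_n sqr_sqrtr; last lra.
  by rewrite -expRM_natl mulrN mulr1.
have arg0 : 0 < KK * l1 / (al ^+ 2 * n%:R) by rewrite divr_gt0// mulr_gt0//; lra.
have tau2sq : tau2 ^+ 2 = KK * l1 / (al ^+ 2 * n%:R) by rewrite sqr_sqrtr// ltW.
have tau01 k : 0 < tau k <= 1.
  rewrite /tau; case: ifP => _; apply/andP; split.
  - by rewrite divr_gt0 ?expR_gt0// sqrtr_gt0.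
  - rewrite ler_pdivrMr ?sqrtr_gt0// mul1r.
    apply: (@le_trans _ _ 1); first by rewrite expR_le1; lra.
    by rewrite -[leLHS]sqrtr1 ler_wsqrtr.
  - by rewrite sqrtr_gt0.
  - rewrite -[leRHS]sqrtr1 ler_wsqrtr// ler_pdivrMr ?mul1r; last by rewrite mulr_gt0//; lra.
    apply: le_trans hn'; apply: ler_pM; [exact: ltW|lra| |].
      by rewrite /KK /C ler_pM2r ?invr_gt0//; lra.
    apply: le_trans (le_trans LLam dLL); rewrite /Lam; lra.
(* The theorem counts a classical set, the lemmas a finite set. *)
have alG' : al * n%:R <= #|[set i : 'I_n | `|eta i| <= 1]%SET|%:R.
  apply: (le_trans alG); rewrite ler_nat; apply: subset_leq_card.
  by apply/fintype.subsetP => i; rewrite !inE.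
have [E [mE PE recur opn]] := good_event t0 mX mW mSg mPi lX lW ind beta lSg lPi n0 d0 dn al01 alG' (fun k _ => tau01 k).
exists E; split=> //; split; last first.
  apply: le_trans PE; rewrite lee_fin lerD2l lerN2.
  apply: (failure_bound d0 eps01 L1 t0 th
    (a := fun k => al * (block_size n t k)%:R / 12)
    (x := fun k => (tau k * vote_rate * al) ^+ 2 * (block_size n t k)%:R / 32)).
  - move=> k kt; rewrite -/l1 -/Lam.
    have h1 : C * (1 * Lam) <= C * (d%:R * Lam) by rewrite ler_pM2l// ler_pM2r//; lra.
    have h2 : 36 * 40 * 8 * Lam <= C * Lam by rewrite ler_wpM2r.
    have h3 : al ^+ 2 * (block_size n t k)%:R <= al * (block_size n t k)%:R by rewrite ler_wpM2r.
    move: (amL k) h1 h2 h3; clear -Lam0; move: (block_size n t k)%:R => m; lra.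
  - move=> k kt; rewrite -/l1 -/Lam /tau kt 2!exprMn tau1sq -/v.
    have e9 : 1 / 9 <= expR (- 2) :> R.
      have Ee : expR (- 2) * expR 1 ^+ 2 = 1 :> R by rewrite -expRM_natl -expRD mulr1 addNr expR0.
      have h := @expR1_le3 R; have hp := expR_gt0 (1 : R).
      have h9 : expR 1 ^+ 2 <= 9 :> R by rewrite expr2; nra.
      have := expR_gt0 (- 2 : R); move: (expR (-2)) (expR 1 ^+ 2) Ee h9 => x y; clear; nra.
    have h1 : v ^+ 2 * expR (- 2) / d%:R * (C * (d%:R * Lam)) <=
        v ^+ 2 * expR (- 2) / d%:R * (8 * (al ^+ 2 * (block_size n t k)%:R)).
      by rewrite ler_pM2l// divr_gt0// mulr_gt0// expR_gt0.
    have E1 : v ^+ 2 * expR (- 2) / d%:R * (C * (d%:R * Lam)) = 36 * 40 * 8 * expR (- 2) * Lam.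
      by rewrite -Cv; field; rewrite gt_eqF.
    have h2 : 1 / 9 * Lam <= expR (- 2) * Lam by rewrite ler_wpM2r.
    move: h1 h2; rewrite E1 [X in _ <= X / 32](_ : _ = v ^+ 2 * expR (- 2) / d%:R * (al ^+ 2 * (block_size n t k)%:R)); last by ring.
    rewrite [X in _ <= X -> _]mulrCA.
    move: (v ^+ 2 * expR (- 2) / d%:R * _) => u; move: (expR (- 2)) => w; clear -Lam0; lra.
  - rewrite -/l1 /tau ltnn 2!exprMn tau2sq -/v.
    have -> : KK * l1 / (al ^+ 2 * n%:R) * v ^+ 2 * al ^+ 2 * (block_size n t t.-1)%:R / 32 =
        16 * 40 * l1 * ((block_size n t t.-1)%:R / n%:R) / 32.
      by rewrite -Kv; field; rewrite !gt_eqF.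
    have h : 1 / 4 <= (block_size n t t.-1)%:R / n%:R :> R.
      by rewrite ler_pdivlMr// /block_size ltnn; lra.
    have : l1 * (1 / 4) <= l1 * ((block_size n t t.-1)%:R / n%:R) by rewrite ler_pM2l//; lra.
    move: (_ / n%:R) => u; clear; lra.
  - by rewrite -/l1 -/Lam; have := big _ Lam0 (le_trans LLam dLL); lra.
move=> om /= /[dup] Eom /recur rec.
have ob := opn om Eom.
set B := fun k => sqnorm (residual t X W Sg beta eta (Pi om) k om).
have B10 : B t.-1 <= 10.
  apply: (@affine_contraction R B Delta t.-1) => //; first by rewrite prednK.
    rewrite /B /sqnorm /residual /estimate /=.
    under eq_bigr do rewrite subr0.
    have q0 : 0 <= \sum_(j < d) beta j ^+ 2 by apply: sumr_ge0 => j _; exact: sqr_ge0.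
    rewrite -(sqr_sqrtr q0) lerXn2r ?nnegrE//; [exact: ltW|lra].
  move=> k kt; have kt' : (k < t)%N by apply: leq_trans kt (leq_pred _).
  apply: (le_trans (rec k kt')).
  by rewrite /tau kt tau1sq mulrCA divff ?mulr1// gt_eqF.
(* The last round does not contract further but replaces the constant error by 11 d tau2^2. *)
have Bt : B t <= d%:R * tau2 ^+ 2 * 11.
  have lt_t : (t.-1 < t)%N by rewrite prednK.
  have := rec _ lt_t; rewrite prednK// /tau ltnn => h; apply: (le_trans h).
  have u0 : 0 <= d%:R * tau2 ^+ 2 by apply: mulr_ge0; [exact: ltW|exact: sqr_ge0].
  apply: (ler_wpM2l u0).
  by have := B10; rewrite /B /=; move: (sqnorm _) => z; clear; lra.
have h := ob (residual t X W Sg beta eta (Pi om) t om).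
apply: (@le_trans _ _ (n%:R^-1 * (8 * 68 * n%:R * B t))).
  by rewrite ler_pM2l ?invr_gt0//; exact: h.
have -> : n%:R^-1 * (8 * 68 * n%:R * B t) = 8 * 68 * B t by field; rewrite gt_eqF.
apply: (@le_trans _ _ (8 * 68 * (d%:R * tau2 ^+ 2 * 11))); first by rewrite ler_pM2l// mulr_gt0.
rewrite tau2sq le_eqVlt; apply/orP; left; apply/eqP; rewrite -/l1.
by field; rewrite !gt_eqF.
Qed.
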